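(* Let $*$ denote either $mir$ (the Lorentz mirror model) or $mat$ (the Manhattan model), on the cylinder $\mathbb{Z}\times C_n$ with $n\ge 2$ even and mirror probability $p\in(0,1]$, and let $V^{*}_{n/2}$ be the random variable defined in the context. (a) Let $C>0$ be a constant and suppose $p\le Cn^{-1}$. Then for all $\alpha>0$, $$\mathbb{P}\left[V^{*}_{n/2}\ge \alpha p^{-2}\right]\le 2A_{*}\,e^{-\frac{1}{8e^{C}}\alpha},$$ where $A_{mir}=\cosh(\pi)$ and $A_{mat}=\frac{\sinh(\pi)}{\pi}$. (b) For any $p\le\frac12$ (not necessarily satisfying $p\le Cn^{-1}$) and for all $\alpha>0$, $$\mathbb{P}\left[V^{*}_{n/2}\le \alpha p^{-2}\right]\le 2\alpha.$$
   Context: Let $n\ge 2$ be even. The cylinder is the lattice $\mathbb{Z}\times C_n$, where $C_n$ is the cycle with vertices $1,\dots,n$ in cyclic order. The $t$-th street is the horizontal row $s_t=\{t\}\times C_n$, with $s_{t+1}$ directly north of (above) $s_t$; the columns are the vertical lines $\mathbb{Z}\times\{i\}$; ''east'' is the direction of increasing $i$ along $C_n$. Each vertex carries, independently with probability $p$, a two-sided mirror at $45^\circ$, and otherwise no mirror. A NW mirror has shape ''\'' (it runs from the north-west to the south-east) and a NE mirror has shape ''/''. A ray of light travels along lattice edges, goes straight at vertices without a mirror, and is reflected (turned by $90^\circ$) at mirrors. Mirror model ($mir$): each mirror present is independently NW or NE with probability $\frac12$ each. Manhattan model ($mat$): the lattice lines are given alternating directions: column $i$ is southbound for $i$ odd and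 northbound for $i$ even; street $s_t$ is eastbound for $t$ odd and westbound for $t$ even. The orientation of a mirror is determined by its location so that rays always follow the directions of the lattice: it is NW if the two lines through the vertex are (southbound, eastbound) or (northbound, westbound), and NE otherwise. Diagrams. A diagram is a perfect matching of the $2n$ points $1^+,\dots,n^+$ (northern) and $1^-,\dots,n^-$ (southern). A pair of two northern points, or of two southern points, is called a bar; the number of northern bars equals the number of southern bars, and this common number is called the number of bars of the diagram. A pair of a northern and a southern point is called a NS path. For streets $s_1,\dots,s_i$, put $j^-$ on the vertical edge of column $j$ just below $s_1$ and $j^+$ on the vertical edge of column $j$ just above $s_i$. The light paths inside the strip formed by $s_1,\dots,s_i$ (closed loops being ignored) match these $2n$ points and so give a random diagram. $V^{*}_{n/2}$ is the smallest $i\ge1$ such that the diagram of the strip $s_1,\dots,s_i$ in model $*$ has exactly $\frac n2$ bars, i.e. has no NS path (no light path within the strip joins its lower boundary to its upper boundary). *)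

(* Defs.v *)
From HB Require Import structures.
From mathcomp Require Import all_boot all_order all_algebra.
From mathcomp Require Import all_classical all_reals all_analysis.

Set Implicit Arguments.
Unset Strict Implicit.
Unset Printing Implicit Defensive.

Import Order.TTheory GRing.Theory Num.Theory.

Local Open Scope ring_scope.

Inductive model := Mir | Mat.

(** [NW] is the mirror "\", [NE] is the mirror "/". *)
Inductive orientation := NW | NE.

(** [None] means that there is no mirror at the vertex. *)
Definition mirror := option orientation.

Inductive direction := North | East | South | West.

(** The vertex (t, i) lies on the street s_t and on column i + 1: the columns
    1, ..., n of C_n are represented by the ordinals 0, ..., n - 1. *)
Definition vertex (n : nat) := (int * 'I_n)%type.

Definition column_number (n : nat) (i : 'I_n) : nat := i.+1.

Definition column_direction (n : nat) (i : 'I_n) : direction :=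
  if odd (column_number i) then South else North.

Definition street_direction (t : int) : direction :=
  if odd `|t|%N then East else West.

Definition manhattan_orientation (n : nat) (v : vertex n) : orientation :=
  match column_direction v.2, street_direction v.1 with
  | South, East | North, West => NW
  | _, _ => NE
  end.

(** Outgoing direction of a ray arriving at a vertex with direction [d]. *)
Definition reflect_ray (m : mirror) (d : direction) : direction :=
  match m, d with
  | None, _ => d
  | Some NW, North => West
  | Some NW, West => North
  | Some NW, South => East
  | Some NW, East => South
  | Some NE, North => East
  | Some NE, East => North
  | Some NE, South => West
  | Some NE, West => South
  end.

Definition neighbour (n : nat) (v : vertex n) (d : direction) : vertex n :=
  match d with
  | North => (v.1 + 1, v.2)
  | South => (v.1 - 1, v.2)
  | East => (v.1, ordS v.2)
  | West => (v.1, ord_pred v.2)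
  end.

(** The ray (v, d) is on the lattice edge through which one arrives at v when
    moving in direction d. *)
Definition ray (n : nat) := (vertex n * direction)%type.

Definition configuration (n : nat) := vertex n -> mirror.

(** Rays move inside the strip s_1, ..., s_h and stop once they have left it. *)
Definition ray_step (n : nat) (cfg : configuration n) (h : nat) (r : ray n) :
    ray n :=
  let: (v, d) := r in
  if 1 <= v.1 <= h%:Z then
    let d' := reflect_ray (cfg v) d in (neighbour v d', d')
  else r.

(** (true, j) is the northern point j^+ and (false, j) the southern point
    j^-. *)
Definition point (n : nat) := (bool * 'I_n)%type.

Definition ray_in (n h : nat) (x : point n) : ray n :=
  if x.1 then ((h%:Z, x.2), South) else ((1%:Z, x.2), North).

Definition ray_out (n h : nat) (x : point n) : ray n :=
  if x.1 then ((h.+1%:Z, x.2), North) else ((0%:Z, x.2), South).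

Definition matched (n : nat) (cfg : configuration n) (h : nat)
    (x y : point n) : Prop :=
  exists k : nat, iter k (ray_step cfg h) (ray_in h x) = ray_out h y.

Definition diagram (n : nat) (cfg : configuration n) (h : nat) :
    {set {set point n}} :=
  [set B | [exists x, exists y, `[< matched cfg h x y >] && (B == [set x; y])]].

Definition num_bars (n : nat) (D : {set {set point n}}) : nat :=
  #|[set B in D | [forall x in B, x.1]]|.

Local Open Scope classical_set_scope.

(** V_{n/2}, with the value +oo if no strip s_1, ..., s_i has n/2 bars. *)
Definition V_half (R : realType) (n : nat) (cfg : configuration n) : \bar R :=
  ereal_inf [set (i%:R : R)%:E | i in
    [set i : nat | (1 <= i)%N /\ num_bars (diagram cfg i) = n./2]].

Definition mirror_law (R : realType) (md : model) (n : nat) (p : R)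
    (v : vertex n) (m : mirror) : R :=
  match m with
  | None => 1 - p
  | Some o =>
    match md with
    | Mir => p / 2
    | Mat =>
      match manhattan_orientation v, o with
      | NW, NW | NE, NE => p
      | _, _ => 0
      end
    end
  end.

Definition independent_mirrors (R : realType) (d : measure_display)
    (T : measurableType d) (P : probability T R) (n : nat)
    (X : vertex n -> T -> mirror) : Prop :=
  forall (s : seq (vertex n)) (A : vertex n -> set mirror), uniq s ->
    P [set w | forall v, v \in s -> A v (X v w)] =
    (\prod_(v <- s) P (X v @^-1` A v))%E.

Definition random_mirrors (R : realType) (md : model) (n : nat) (p : R)
    (d : measure_display) (T : measurableType d) (P : probability T R)
    (X : vertex n -> T -> mirror) : Prop :=
  [/\ forall (v : vertex n) (A : set mirror), measurable (X v @^-1` A),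
      forall (v : vertex n) (m : mirror),
        P (X v @^-1` [set m]) = (mirror_law md p v m)%:E
    & independent_mirrors P X].

Definition cosh (R : realType) (x : R) : R := (expR x + expR (- x)) / 2.

Definition sinh (R : realType) (x : R) : R := (expR x - expR (- x)) / 2.

Definition A_const (R : realType) (md : model) : R :=
  match md with
  | Mir => cosh pi
  | Mat => sinh pi / pi
  end.

(* Main.v *)
(** The number of NS paths of the strip [s_1, ..., s_h] is even and does not
    increase with [h], and [V_(n/2)] is the first [h] at which it vanishes.

    (b) A NS path goes straight on through the next street unless there is a
    mirror at its top.  The last NS paths, at least two of them, thus need two
    mirrors in one street, so each street is the last one with probability at
    most [p^2].

    (a) Two NS paths with tops [a] and [b] are joined by the next street when it
    has facing mirrors at [a] and [b] and no mirror on the arc from [a] to [b].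
    If [2k] paths are left and blocks of [L] streets destroy some of them with
    probability at least [q_k], where the sum of the [L theta / q_k] is at most
    3/4, then the probability of survival decays like [4 exp (- theta h)], and
    [4 exp (2 theta)] is at most [2 A].  This is applied with
    [theta = p^2 exp (- p n) / 8], that is, with [C = p n].  For
    [p^2 n <= 2/3] one counts the streets with exactly two mirrors; for larger
    [p] one chooses the shorter of the two arcs between two NS paths (in the
    Manhattan model each arc is available in every second street only, which
    costs a block of two streets); for [p >= 1/2] (Manhattan) or [p >= 3/4]
    (Lorentz) a block of two streets contains with large enough probability a
    closed wall of mirrors around the cylinder. *)
Require Import Defs.
From HB Require Import structures.
From mathcomp Require Import all_boot all_order all_algebra.
From mathcomp Require Import all_classical all_reals all_analysis.
From mathcomp Require Import zify ring lra.

Set Implicit Arguments.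
Unset Strict Implicit.
Unset Printing Implicit Defensive.

Import Order.TTheory GRing.Theory Num.Theory.

Local Open Scope ring_scope.

(** * Rays inside a strip *)

Definition orientation_to_bool (o : orientation) : bool :=
  if o is NW then true else false.

Definition orientation_of_bool (b : bool) : orientation :=
  if b then NW else NE.

Lemma orientation_to_boolK : cancel orientation_to_bool orientation_of_bool.
Proof. by case. Qed.

HB.instance Definition _ := Finite.copy orientation
  (can_type orientation_to_boolK).

Definition opposite (d : direction) : direction :=
  match d with North => South | East => West | South => North | West => East end.

Definition direction_code (d : direction) : bool * bool :=
  match d with
  | North => (true, true) | East => (true, false)
  | South => (false, true) | West => (false, false)
  end.

Lemma direction_code_inj : injective direction_code.
Proof. by do 2!case. Qed.

Lemma oppositeK : involutive opposite.
Proof. by case. Qed.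

Lemma opposite_neq d : opposite d <> d.
Proof. by case: d. Qed.

Lemma reflect_ray_opposite m d :
  reflect_ray m (opposite (reflect_ray m d)) = opposite d.
Proof. by case: m => [[]|]; case: d. Qed.

Lemma reflect_ray_neq_opposite m d : reflect_ray m d <> opposite d.
Proof. by case: m => [[]|]; case: d. Qed.

Section Rays.
Variable n : nat.
Implicit Types (v : vertex n) (r s : ray n) (cfg : configuration n).

Lemma neighbour_opposite v d : neighbour (neighbour v d) (opposite d) = v.
Proof.
by case: v => t i; case: d; rewrite /neighbour /= ?addrK ?subrK ?ordSK ?ord_predK.
Qed.

(** A ray is named after the vertex ahead of it, so the same edge run backwards is named after the
    vertex at its other end. *)
Definition reverse r : ray n := (neighbour r.1 (opposite r.2), opposite r.2).

Lemma reverseK : involutive reverse.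
Proof.
by case=> v d; rewrite /reverse /= neighbour_opposite oppositeK.
Qed.

Definition inside (h : nat) r : bool := 1 <= r.1.1 <= h%:Z.

Definition reach cfg h r s : Prop := exists k, iter k (ray_step cfg h) r = s.

Lemma ray_step_inside cfg h r : inside h r ->
  ray_step cfg h r =
  (neighbour r.1 (reflect_ray (cfg r.1) r.2), reflect_ray (cfg r.1) r.2).
Proof. by case: r => v d; rewrite /inside /ray_step /= => ->. Qed.

Lemma ray_step_outside cfg h r : ~~ inside h r -> ray_step cfg h r = r.
Proof. by case: r => v d; rewrite /inside /ray_step /= => /negbTE ->. Qed.

Lemma iter_ray_step_outside cfg h k r :
  ~~ inside h r -> iter k (ray_step cfg h) r = r.
Proof.
move=> nr; elim: k => //= k ->; exact: ray_step_outside.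
Qed.

Lemma reach_refl cfg h r : reach cfg h r r.
Proof. by exists 0%N. Qed.

Lemma reach_step cfg h r s t :
  ray_step cfg h r = s -> reach cfg h s t -> reach cfg h r t.
Proof. by move=> <- [k <-]; exists k.+1; rewrite iterSr. Qed.

Lemma reach_trans cfg h s r t :
  reach cfg h r s -> reach cfg h s t -> reach cfg h r t.
Proof. by move=> [k <-] [l <-]; exists (l + k)%N; rewrite iterD. Qed.

(** Light is reversible because mirrors are two-sided. It suffices that [r] is inside: the reverse
    of its successor arrives at the vertex of [r]. *)
Lemma ray_step_reverse cfg h r : inside h r ->
  ray_step cfg h (reverse (ray_step cfg h r)) = reverse r.
Proof.
move=> hr; rewrite (ray_step_inside cfg hr) {1}/reverse [_.1]/= [_.2]/=.
by rewrite neighbour_opposite ray_step_inside //= reflect_ray_opposite.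
Qed.

Lemma ray_step_inj cfg h r s : inside h r -> inside h s ->
  ray_step cfg h r = ray_step cfg h s -> r = s.
Proof.
move=> hr hs E; apply: (can_inj reverseK).
by rewrite -(ray_step_reverse cfg hr) E ray_step_reverse.
Qed.

Lemma reach_reverse cfg h r s :
  reach cfg h r s -> reach cfg h (reverse s) (reverse r).
Proof.
move=> [k]; elim: k r => [|k IH] r; first by move=> <-; exact: reach_refl.
rewrite iterSr => /IH rs; have [hr|nr] := boolP (inside h r).
  apply: reach_trans rs _; apply: reach_step (reach_refl _ _ _).
  exact: ray_step_reverse.
by rewrite ray_step_outside in rs.
Qed.

Lemma reverse_ray_in h (x : Defs.point n) : reverse (ray_in h x) = ray_out h x.
Proof.
by case: x => [[] j]; rewrite /reverse /ray_in /ray_out /= ?subrr //;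
  congr ((_, _), _); lia.
Qed.

Lemma reverse_ray_out h (x : Defs.point n) : reverse (ray_out h x) = ray_in h x.
Proof. by rewrite -reverse_ray_in reverseK. Qed.

Lemma outside_ray_out h (x : Defs.point n) : ~~ inside h (ray_out h x).
Proof. by case: x => [[] j]; rewrite /inside /ray_out /=; lia. Qed.

Lemma ray_out_inj h : injective (@ray_out n h).
Proof. by case=> [[] i] [[] j] //= []; rewrite ?addn1 => *; subst. Qed.

Lemma reach_ray_out_unique cfg h r x y :
  reach cfg h r (ray_out h x) -> reach cfg h r (ray_out h y) -> x = y.
Proof.
move=> [k Ek] [l El].
wlog le_kl : k l x y Ek El / (k <= l)%N.
  move=> H; case: (leqP k l) => [|/ltnW] /H; first by apply.
  by move=> H'; symmetry; exact: H'.
apply: (@ray_out_inj h).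
by rewrite -El -(subnK le_kl) iterD Ek iter_ray_step_outside ?outside_ray_out.
Qed.

Lemma matched_sym cfg h x y : matched cfg h x y -> matched cfg h y x.
Proof. by move=> /reach_reverse; rewrite reverse_ray_in reverse_ray_out. Qed.

(* A path equal to its own reversal would have a midpoint where the ray turns
   back. *)
Lemma iter_ray_step_neq_reverse cfg h k r :
  iter k (ray_step cfg h) r <> reverse r.
Proof.
elim/ltn_ind: k r => k IH r; have [hr|nr] := boolP (inside h r); last first.
  rewrite iter_ray_step_outside // => E.
  by apply: (@opposite_neq r.2); rewrite {2}E.
case: k IH => [|[|k]] IH.
- by move=> /= E; apply: (@opposite_neq r.2); rewrite {2}E.
- rewrite /= ray_step_inside // => -[_]; exact: reflect_ray_neq_opposite.
set s := ray_step cfg h r => E.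
have := E; rewrite iterS iterSr -/s -(ray_step_reverse cfg hr) -/s.
have [hu|nu] := boolP (inside h (iter k (ray_step cfg h) s)).
  move/ray_step_inj; rewrite hu => /(_ isT) H.
  apply: (IH k _ s) => //; apply: H.
  by rewrite /s ray_step_inside // /reverse /= /inside /= neighbour_opposite.
rewrite ray_step_outside // (ray_step_reverse cfg hr) => E'.
by apply: (IH k.+1 _ r) => //; rewrite iterSr.
Qed.

Lemma matched_irrefl cfg h x : ~ matched cfg h x x.
Proof.
by move=> [k]; rewrite -reverse_ray_in; exact: iter_ray_step_neq_reverse.
Qed.

(** A ray that never leaves repeats a state. Steps are injective inside the strip, so the repetition
    can be pulled back to the entering ray, which would then come from a vertex inside the strip. *)
Lemma ray_exits cfg h (x : Defs.point n) :
  exists k, ~~ inside h (iter k (ray_step cfg h) (ray_in h x)).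
Proof.
apply: contrapT => /forallNP all_in.
set f := fun k => iter k (ray_step cfg h) (ray_in h x).
have fS k : f k.+1 = ray_step cfg h (f k) by [].
have {}all_in k : inside h (f k) by have := all_in k; rewrite /f; case: inside.
(* A finite code of the inside rays; [inord] is faithful there, as the street number lies between
   [1] and [h]. *)
pose code (r : ray n) : 'I_h.+1 * 'I_n * (bool * bool) :=
  (inord `|r.1.1|%N, r.1.2, direction_code r.2).
have code_inj r s : inside h r -> inside h s -> code r = code s -> r = s.
  case: r => [[t i] d]; case: s => [[t' i'] d']; rewrite /inside /code /=.
  move=> ht ht' [] /(congr1 val); rewrite /= !inordK; [|lia|lia].
  move=> Et -> Ed; congr ((_, _), _); first lia.
  by apply: direction_code_inj.
set N := #|{: 'I_h.+1 * 'I_n * (bool * bool)}|.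
have [i [j [lt_ij Eij]]] : exists i j, (i < j)%N /\ f i = f j.
  apply: contrapT => no_rep.
  have inj : injective (fun k : 'I_N.+1 => code (f k)).
    move=> k l /(code_inj _ _ (all_in _) (all_in _)) E; apply/val_inj.
    by case: (ltngtP k l) => // lt; case: no_rep; [exists k, l|exists l, k].
  by have := leq_card _ inj; rewrite card_ord ltnn.
have {Eij lt_ij} [m Em] : exists m, f m.+1 = f 0%N.
  exists (j - i).-1; rewrite prednK ?subn_gt0 //.
  elim: i j lt_ij Eij => [|i IH] j lt_ij Eij; first by rewrite subn0.
  case: j lt_ij Eij => // j lt_ij; rewrite !fS subSS => Eij.
  exact: IH _ lt_ij (ray_step_inj (all_in _) (all_in _) Eij).
have := all_in m; have := outside_ray_out h x.
rewrite -reverse_ray_in -[ray_in h x]/(f 0%N) -Em fS ray_step_inside //.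
by rewrite /reverse /inside /= neighbour_opposite => /negbTE ->.
Qed.

Lemma exists_matched cfg h x : exists y, matched cfg h x y.
Proof.
pose f k := iter k (ray_step cfg h) (ray_in h x).
have ex : exists k, ~~ inside h (f k) by exact: ray_exits.
have fS k : f k.+1 = ray_step cfg h (f k) by [].
case: (ex_minnP ex) => -[|k] Hk min.
  (* This happens only for [h = 0], where entering on one side is already leaving on the other. *)
  exists (~~ x.1, x.2); exists 0%N; move: Hk; rewrite /f /=.
  by case: x {f fS ex min} => [[] j]; rewrite /inside /ray_in /ray_out /= => H;
    congr ((_, _), _); lia.
have hk : inside h (f k).
  by apply: contraT => /min; rewrite ltnn.
move: Hk; rewrite fS ray_step_inside //; set d := reflect_ray _ _ => Hk.
suff [y Ey] : exists y, ray_out h y = (neighbour (f k).1 d, d).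
  by exists y; exists k.+1; rewrite -[iter _ _ _]/(f k.+1) fS ray_step_inside.
move: hk Hk; rewrite /inside /=; case: (f k).1 => t i /=.
case: (d) => /=.
- by exists (true, i); rewrite /ray_out /=; congr ((_, _), _); lia.
- lia.
- by exists (false, i); rewrite /ray_out /=; congr ((_, _), _); lia.
- lia.
Qed.

(** Choice turns the matching into a function; by [exists_matched] the default [x] is never
    returned. *)
Definition exit_point cfg h (x : Defs.point n) : Defs.point n :=
  xget x [set y | matched cfg h x y]%classic.

Lemma matched_exit cfg h x : matched cfg h x (exit_point cfg h x).
Proof.
have [y xy] := exists_matched cfg h x.
exact: (@xgetI _ x [set y | matched cfg h x y]%classic y).
Qed.

Lemma exit_pointP cfg h x y : matched cfg h x y <-> exit_point cfg h x = y.
Proof.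
split=> [|<-]; last exact: matched_exit.
exact: reach_ray_out_unique (matched_exit _ _ _).
Qed.

Lemma exit_pointK cfg h : involutive (exit_point cfg h).
Proof. by move=> x; apply/exit_pointP/matched_sym/matched_exit. Qed.

Lemma exit_point_neq cfg h x : exit_point cfg h x != x.
Proof. by apply/eqP => /exit_pointP; exact: matched_irrefl. Qed.

(** The columns of the NS paths, read at the northern ([b = true]) or at the
    southern ([b = false]) boundary. *)
Definition crossing (b : bool) cfg h : {set 'I_n} :=
  [set j | (exit_point cfg h (b, j)).1 == ~~ b].

(** Following the NS paths injects their ends on one boundary into those on the other. *)
Lemma leq_card_crossing b cfg h :
  (#|crossing b cfg h| <= #|crossing (~~ b) cfg h|)%N.
Proof.
rewrite -(@card_in_imset _ _ (fun j => (exit_point cfg h (b, j)).2)).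
  apply/subset_leq_card/fintype.subsetP => k /imsetP[j]; rewrite !inE => /eqP Ej ->.
  by rewrite -Ej -surjective_pairing exit_pointK Ej negbK.
move=> i j; rewrite !inE => /eqP Ei /eqP Ej E.
have : exit_point cfg h (b, i) = exit_point cfg h (b, j).
  by rewrite [LHS]surjective_pairing [RHS]surjective_pairing Ei Ej E.
by move/(can_inj (exit_pointK cfg h)) => -[].
Qed.

Lemma card_crossing b cfg h :
  #|crossing b cfg h| = #|crossing false cfg h|.
Proof.
case: b => //; apply/eqP.
by rewrite eqn_leq (leq_card_crossing true) (leq_card_crossing false).
Qed.

Lemma exit_point_crossing b cfg h j : j \in crossing b cfg h ->
  exit_point cfg h (b, j) = (~~ b, (exit_point cfg h (b, j)).2) /\
  (exit_point cfg h (b, j)).2 \in crossing (~~ b) cfg h.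
Proof.
rewrite !inE => /eqP Ej; split; first by rewrite -Ej -surjective_pairing.
by rewrite -Ej -surjective_pairing exit_pointK Ej negbK.
Qed.

(** The [n] northern points are the ends of northern bars, two for each bar, and the tops of NS
    paths. *)
Lemma num_bars_crossing cfg h :
  ((num_bars (diagram cfg h)).*2 + #|crossing false cfg h|)%N = n.
Proof.
rewrite /num_bars; set P := [set B in _ | _]; set f := exit_point cfg h.
(* The northern points on bars; the involution [f] has no fixed point, so its orbits split [U] into
   pairs. *)
pose U := [set x : Defs.point n | x.1 & (f x).1].
have E : P = [set [set x; f x] | x in U].
  apply/finset.setP => B; rewrite !inE; apply/andP/imsetP.
    move=> -[/existsP[x /existsP[y /andP[/asboolP /exit_pointP xy /eqP EB]]]].
    move=> /forallP H; exists x; last by rewrite EB /f xy.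
    have := H x; have := H y; rewrite !inE EB !inE !eqxx orbT /=.
    by rewrite /f xy => -> ->.
  move=> [x]; rewrite inE => /andP[x1 fx1] ->; split; last first.
    by apply/forallP => y; apply/implyP; rewrite !inE => /orP[] /eqP ->.
  apply/existsP; exists x; apply/existsP; exists (f x).
  by rewrite eqxx andbT; apply/asboolP/matched_exit.
have partP : finset.partition P U.
  apply/and3P; split.
  - apply/eqP/setP => y; apply/finset.bigcupP/idP.
      move=> [B]; rewrite E => /imsetP[x]; rewrite inE => /andP[x1 fx1] ->.
      by rewrite !inE => /orP[] /eqP ->; rewrite ?x1 ?fx1 // /f exit_pointK x1.
    move=> yU; exists [set y; f y]; last by rewrite !inE eqxx.
    by rewrite E; apply/imsetP; exists y.
  - apply/finset.trivIsetP => A B; rewrite E => /imsetP[x _ ->] /imsetP[y _ ->] neq.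
    rewrite -finset.setI_eq0; apply: contraR neq => /finset.set0Pn[z]; rewrite !inE.
    have fK := exit_pointK cfg h.
    case/andP=> /orP[] /eqP -> /orP[] /eqP Exy.
    + by rewrite Exy.
    + by rewrite Exy /f fK finset.setUC.
    + by rewrite -Exy /f fK finset.setUC.
    + by rewrite (can_inj fK Exy).
  - by rewrite E; apply/imsetP => -[x _ /setP /(_ x)]; rewrite !inE eqxx.
have cardU : #|U| = (#|P| * 2)%N.
  apply: card_uniform_partition partP => A; rewrite E => /imsetP[x _ ->].
  by rewrite cards2 eq_sym exit_point_neq.
rewrite -muln2 -cardU -(card_crossing true) -[RHS]card_ord.
rewrite -(cardsC (crossing true cfg h)) addnC; congr addn.
rewrite -[RHS](@card_imset _ _ (pair true)); last by move=> i j [].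
apply: eq_card => -[b j]; rewrite [LHS]inE; apply/andP/imsetP => /=.
  move=> [-> fj]; exists j => //; rewrite !inE; move: fj.
  by rewrite -/f; case: (f _).1.
move=> [k]; rewrite !inE -/f => Hk [-> ->]; split=> //; move: Hk.
by case: (f _).1.
Qed.

End Rays.

(** * Adding a street *)

Section Strips.
Variable n : nat.
Implicit Types (cfg : configuration n) (a b j : 'I_n).

Lemma eq_ray_step cfg1 cfg2 h :
    (forall v, 1 <= v.1 <= h%:Z -> cfg1 v = cfg2 v) ->
  ray_step cfg1 h = ray_step cfg2 h.
Proof.
by move=> E; apply/funext => -[v d]; rewrite /ray_step; case: ifP => // /E ->.
Qed.

Lemma eq_crossing cfg1 cfg2 h (b : bool) :
    (forall v, 1 <= v.1 <= h%:Z -> cfg1 v = cfg2 v) ->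
  crossing b cfg1 h = crossing b cfg2 h.
Proof.
by move=> /eq_ray_step E; rewrite /crossing /exit_point /matched E.
Qed.

Lemma reach_extend cfg h (r s : ray n) : reach cfg h r s -> reach cfg h.+1 r s.
Proof.
move=> [k]; elim: k r => [|k IH] r; first by move=> <-; exact: reach_refl.
rewrite iterSr => /IH; have [hr|nr] := boolP (inside h r).
  apply: reach_step; rewrite !ray_step_inside //.
  by move: hr; rewrite /inside; lia.
by rewrite ray_step_outside.
Qed.

(** A southern bar survives the addition of a street on top. The northern ends would not give nested
    sets, since a street may shift the columns of the tops. *)
Lemma crossing_subset cfg h :
  crossing false cfg h.+1 \subset crossing false cfg h.
Proof.
apply/fintype.subsetP => j; rewrite !inE /=; apply: contraLR => nj.
have /reach_extend : matched cfg h (false, j) (exit_point cfg h (false, j)).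
  exact: matched_exit.
case: exit_point nj => -[] k //= _ jk.
by have /exit_pointP -> : matched cfg h.+1 (false, j) (false, k) by [].
Qed.

Lemma crossing_subset_leq cfg h k : (h <= k)%N ->
  crossing false cfg k \subset crossing false cfg h.
Proof.
move=> /subnK <-; elim: (k - h)%N => // m IH.
exact: fintype.subset_trans (crossing_subset _ _) IH.
Qed.

(** The number of steps east from [a] to [b] on the cycle; adding [n] first keeps the subtraction
    from truncating. *)
Definition dist a b : nat := (b + n - a) %% n.

Lemma val_iter_ordS a k : val (iter k (@ordS n) a) = ((a + k) %% n)%N.
Proof.
elim: k => [|k IH]; first by rewrite addn0 modn_small.
by rewrite iterS /= IH -addn1 modnDml addn1 addnS.
Qed.

Lemma iter_ordS_dist a b : iter (dist a b) (@ordS n) a = b.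
Proof.
apply/val_inj; rewrite val_iter_ordS /dist modnDmr.
have -> : (a + (b + n - a) = b + n)%N by have := ltn_ord a; lia.
by rewrite modnDr modn_small.
Qed.

Lemma dist_iter_ordS a k : (k < n)%N -> dist a (iter k (@ordS n) a) = k.
Proof.
move=> lt_kn; rewrite /dist val_iter_ordS; have lt_an := ltn_ord a.
case: (ltnP (a + k) n) => H.
  by rewrite (modn_small H) (_ : _ - _ = k + n)%N ?modnDr ?modn_small //; lia.
have -> : ((a + k) %% n = a + k - n)%N.
  by rewrite -{1}(subnK H) modnDr modn_small //; lia.
by rewrite (_ : _ - _ = k)%N ?modn_small //; lia.
Qed.

Lemma ltn_dist a b : (dist a b < n)%N.
Proof. by rewrite ltn_pmod //; have := ltn_ord a; lia. Qed.

Lemma dist_gt0 a b : a != b -> (0 < dist a b)%N.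
Proof.
move=> neq; rewrite lt0n; apply: contraNneq neq => E.
by rewrite -(iter_ordS_dist a b) E.
Qed.

Lemma distC a b : a != b -> (dist a b + dist b a = n)%N.
Proof.
move=> neq; have lt_an := ltn_ord a; have lt_bn := ltn_ord b.
have {}neq : val a <> val b by move=> /val_inj /eqP; rewrite (negbTE neq).
rewrite /dist; wlog lt_ab : a b lt_an lt_bn neq / (a < b)%N => [H|].
  by case: (ltngtP a b) => // lt; [|rewrite addnC]; apply: H => // /esym.
rewrite (_ : b + n - a = b - a + n)%N; last lia.
rewrite modnDr modn_small; last lia.
by rewrite modn_small; lia.
Qed.

(** A ray going north through column [a] at level [h] is turned by street
    [h + 1] into a ray going south through column [b]. *)
Definition turns cfg h a b : Prop :=
  [/\ a != b, cfg (h.+1%:Z, a) = Some NE, cfg (h.+1%:Z, b) = Some NW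
    & forall c, (0 < dist a c < dist a b)%N -> cfg (h.+1%:Z, c) = None].

Lemma reach_turn cfg h a b : turns cfg h a b ->
  reach cfg h.+1 ((h.+1%:Z, a), North) ((h%:Z, b), South).
Proof.
move=> [neq Ea Eb Ec].
have ins c d : inside h.+1 ((h.+1%:Z, c), d) by rewrite /inside /=; lia.
have east k : (k < dist a b)%N ->
  reach cfg h.+1 ((h.+1%:Z, a), North) ((h.+1%:Z, iter k.+1 (@ordS n) a), East).
  elim: k => [|k IH] lt_k.
    by apply: reach_step (reach_refl _ _ _); rewrite ray_step_inside //= Ea.
  apply: reach_trans (IH (ltnW lt_k)) _; apply: reach_step (reach_refl _ _ _).
  rewrite ray_step_inside //= Ec // -iterS dist_iter_ordS ?lt_k //.
  exact: ltn_trans lt_k (ltn_dist _ _).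
have := east (dist a b).-1; rewrite prednK ?dist_gt0 // iter_ordS_dist.
move=> /(_ (leqnn _)) /reach_trans; apply.
apply: reach_step (reach_refl _ _ _); rewrite ray_step_inside //= Eb /=.
by congr ((_, _), _); lia.
Qed.

(** The two NS paths are joined through the new street, so their feet become the ends of one
    southern bar; the foot below [a] is the witness of the loss. *)
Lemma crossing_turn cfg h a b :
    a \in crossing true cfg h -> b \in crossing true cfg h ->
    turns cfg h a b ->
  (#|crossing false cfg h.+1| < #|crossing false cfg h|)%N.
Proof.
move=> /exit_point_crossing [Ea Ca] /exit_point_crossing [Eb _] /reach_turn tab.
apply/proper_card; apply/properP; split; first exact: crossing_subset.
exists (exit_point cfg h (true, a)).2 => //; rewrite inE.
set j := _.2 in Ea Ca *; set k := _.2 in Eb.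
suff /exit_pointP -> : matched cfg h.+1 (false, j) (false, k) by [].
have /matched_sym /reach_extend ja : matched cfg h (true, a) (false, j).
  exact/exit_pointP.
have /reach_extend bk : matched cfg h (true, b) (false, k) by exact/exit_pointP.
apply: reach_trans ja _; exact: reach_trans tab bk.
Qed.

Lemma crossing_keep cfg h a :
    a \in crossing true cfg h -> cfg (h.+1%:Z, a) = None ->
  a \in crossing true cfg h.+1.
Proof.
move=> /exit_point_crossing [Ea _] Na; rewrite inE.
set j := _.2 in Ea.
suff /matched_sym /exit_pointP -> : matched cfg h.+1 (false, j) (true, a) by [].
have /matched_sym /reach_extend : matched cfg h (true, a) (false, j).
  exact/exit_pointP.
move=> /reach_trans; apply; apply: reach_step (reach_refl _ _ _).
rewrite ray_step_inside; last by rewrite /inside /=; lia.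
by rewrite /= Na /=; congr ((_, _), _); lia.
Qed.

End Strips.

(** * Closed walls of mirrors around the cylinder *)

Section Wall.
Variables (n : nat) (n_even : ~~ odd n).
Implicit Types (cfg : configuration n) (c : 'I_n).

Lemma odd_ordS c : odd (ordS c) = ~~ odd c.
Proof.
rewrite /= (odd_mod _ (negbTE n_even)) //=.
Qed.

Lemma half_ordS c : ~~ odd c -> (ordS c)./2 = c./2.
Proof.
move=> ec; have lt_cn := ltn_ord c.
have lt : (c.+1 < n)%N.
  by rewrite ltn_neqAle lt_cn andbT; apply: contraNneq n_even => <-.
by rewrite /= modn_small // -[c.+1./2]/(uphalf c) uphalf_half (negbTE ec).
Qed.

Lemma odd_ord_pred c : odd (ord_pred c) = ~~ odd c.
Proof. by rewrite -{2}(ord_predK c) odd_ordS negbK. Qed.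

Lemma half_ord_pred c : odd c -> (ord_pred c)./2 = c./2.
Proof.
by move=> oc; rewrite -half_ordS ?ord_predK // odd_ord_pred oc.
Qed.

(** The columns [2k] and [2k + 1] form the block [k], with mirrors "/\" in
    street [h + 2] if [up k] and with mirrors "\/" in street [h + 1]
    otherwise: the mirrors of all blocks form a closed wall. *)
Definition wall cfg h (up : pred nat) : Prop := forall c,
  if up c./2 then cfg (h.+2%:Z, c) = Some (if odd c then NW else NE)
  else cfg (h.+1%:Z, c) = Some (if odd c then NE else NW).

(** The invariant of light on the southern side of the wall. Within the two streets of the wall, the
    side of an edge depends on the parity of the column and on the height of its block. *)
Definition below_wall (h : nat) (up : pred nat) (r : ray n) : bool :=
  let: ((t, c), d) := r in
  if t <= h%:Z then true
  else if t == h.+1%:Z then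
    match d with
    | North => true
    | South => up c./2
    | East => odd c ==> up c./2
    | West => ~~ odd c ==> up c./2
    end
  else if t == h.+2%:Z then
    match d with
    | North => up c./2
    | South => false
    | East => odd c && up c./2
    | West => ~~ odd c && up c./2
    end
  else false.

Lemma below_wall_step cfg h up (r : ray n) : wall cfg h up ->
  below_wall h up r -> below_wall h up (ray_step cfg h.+2 r).
Proof.
case: r => [[t c] d] W; rewrite /ray_step; case: ifP => // /andP[/= t1 th].
case: ifP => [le_th _|gt_th].
  case: reflect_ray; rewrite /below_wall /=.
  - case: ifP => // gt; case: ifP => // /negP; case; apply/eqP; lia.
  - by rewrite le_th.
  - case: ifP => // gt; lia.
  - by rewrite le_th.
have rowS : (t + 1 <= h%:Z) = false by lia.
case: eqP => [Et|nEt].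
  have E1 : (t + 1 == h.+1%:Z) = false by lia.
  have E2 : (t + 1 == h.+2%:Z) by lia.
  have E3 : (t - 1 <= h%:Z) by lia.
  (* Over an [up] block every way out of street [h + 1] is still below the wall; in the other blocks
     the mirrors of this street turn the ray back. *)
  have Wc := W c; rewrite -Et in Wc; move: Wc; case: ifP => up_c.
    move=> _ _; case: reflect_ray; rewrite /below_wall /=.
    - by rewrite rowS E1 E2.
    - rewrite gt_th Et eqxx -[(c.+1 %% n)%N]/(val (ordS c)).
      by apply/implyP; rewrite odd_ordS => ec; rewrite half_ordS.
    - by rewrite E3.
    - rewrite gt_th Et eqxx -[((c + n).-1 %% n)%N]/(val (ord_pred c)).
      apply/implyP; rewrite odd_ord_pred negbK => oc.
      by rewrite half_ord_pred.
  move=> ->; case: d => //=; case: (boolP (odd c)) => oc //=.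
  - rewrite gt_th Et eqxx -[(c.+1 %% n)%N]/(val (ordS c)).
    by rewrite odd_ordS oc.
  - rewrite gt_th Et eqxx -[((c + n).-1 %% n)%N]/(val (ord_pred c)).
    by rewrite odd_ord_pred oc.
  - by rewrite E3.
  - by rewrite E3.
case: eqP => // Et.
have E3 : (t - 1 <= h%:Z) = false by lia.
have E4 : (t - 1 == h.+1%:Z) by lia.
have E5 : (t == h.+1%:Z) = false by lia.
have E6 : (t == h.+2%:Z) by lia.
move=> B; have up_c : up c./2 by case: d B => // /andP[].
have Wc := W c; rewrite up_c -Et in Wc; rewrite Wc.
case: d B => //=; case: (boolP (odd c)) => oc //= _.
- rewrite gt_th E5 E6 -[((c + n).-1 %% n)%N]/(val (ord_pred c)).
  by rewrite odd_ord_pred half_ord_pred // up_c oc.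
- rewrite gt_th E5 E6 -[(c.+1 %% n)%N]/(val (ordS c)).
  by rewrite odd_ordS half_ordS // up_c oc.
- by rewrite E3 E4.
- by rewrite E3 E4.
Qed.

(** Light entering from the south starts below the wall and stays there, whereas a northern exit
    lies above it. *)
Lemma crossing_wall cfg h up : wall cfg h up ->
  #|crossing false cfg h.+2| = 0%N.
Proof.
move=> W; apply/eqP; rewrite cards_eq0; apply/eqP/finset.setP => j; rewrite !inE.
apply/negbTE; have [k] := matched_exit cfg h.+2 (false, j).
case: exit_point => -[] i //= E.
have : below_wall h up (ray_out h.+2 (true, i)).
  rewrite -E; elim: k {E} => [|k IH]; last exact: below_wall_step.
  by rewrite /ray_in /below_wall /=; case: ifP => //; case: eqP => //; lia.
rewrite /ray_out /below_wall /=; case: ifP; first lia.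
by case: eqP; first lia; case: eqP; first lia.
Qed.

End Wall.

(** * Parity of the columns in the Manhattan model *)

Section Manhattan.
Variables (n : nat) (n_even : ~~ odd n).
Implicit Types (cfg : configuration n) (a b j : 'I_n).

Definition manhattan_strip cfg h : Prop := forall v, 1 <= v.1 <= h%:Z ->
  cfg v = None \/ cfg v = Some (manhattan_orientation v).

(** Light that starts along the direction of its line does so for ever. Taking [f = opposite]
    covers, by the same invariant, light that runs against all directions. *)
Lemma column_direction_exit cfg h (f : direction -> direction) (a b : 'I_n) :
    f = id \/ f = opposite -> manhattan_strip cfg h ->
    matched cfg h (true, a) (true, b) ->
  South = f (column_direction a) -> North = f (column_direction b).
Proof.
move=> Hf M [k E] Sa.
pose aligned (r : ray n) :=
  r.2 = f (column_direction r.1.2) \/ r.2 = f (street_direction r.1.1).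
have step v d : aligned (v, d) -> 1 <= v.1 <= h%:Z ->
    aligned (neighbour v (reflect_ray (cfg v) d), reflect_ray (cfg v) d).
  case: v => t c Ad /M Hv; move: Ad; rewrite /aligned /=.
  rewrite /manhattan_orientation /column_direction /street_direction in Hv *.
  rewrite /column_number /= in Hv *; case Ec: (odd c) Hv; case Et: (odd `|t|%N) => -[] -> /= [] ->;
    by case: Hf => -> /=; rewrite ?Ec ?Et; auto.
have : aligned (ray_out h (true, b)).
  rewrite -E; elim: k {E} => [|k]; first by left.
  rewrite iterS; move: (iter k _ _) => [v d] /=.
  by case: ifP => // hv Av; exact: step.
by case=> [//|] /=; rewrite /street_direction; case: Hf => ->; case: odd.
Qed.

Lemma matched_odd_column cfg h a b : manhattan_strip cfg h ->
  matched cfg h (true, a) (true, b) -> odd a = ~~ odd b.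
Proof.
move=> M ab; have [oa|ea] := boolP (odd a).
  have := column_direction_exit (or_intror (erefl opposite)) M ab.
  rewrite /column_direction /column_number /= oa /= => /(_ erefl).
  by case: odd.
have := column_direction_exit (or_introl (erefl id)) M ab.
rewrite /column_direction /column_number /= ea /= => /(_ erefl).
by case: odd.
Qed.

Lemma card_odd_columns (e : bool) :
  #|[set j : 'I_n | odd j == e]| = #|[set j : 'I_n | odd j == ~~ e]|.
Proof.
rewrite -(card_imset _ (@ordS_inj n)); apply: eq_card => j.
apply/imsetP/idP => [[i]|]; rewrite !inE.
  by move=> /eqP <- ->; rewrite odd_ordS.
move=> oj; exists (ord_pred j); last by rewrite ord_predK.
by rewrite inE odd_ord_pred // (eqP oj) negbK.
Qed.

(** Northern bars pair odd with even columns, so both parities are equally frequent on bars; as [n]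
    is even they are equally frequent among all columns, hence also among the tops. *)
Lemma card_odd_crossing cfg h (e : bool) : manhattan_strip cfg h ->
  #|[set j in crossing true cfg h | odd j == e]|.*2 =
  #|crossing true cfg h|.
Proof.
move=> M; set C := crossing true cfg h.
pose U e := [set j : 'I_n | (j \notin C) && (odd j == e)].
have leU e' : (#|U e'| <= #|U (~~ e')|)%N.
  rewrite -(@card_in_imset _ _ (fun j => (exit_point cfg h (true, j)).2)).
    apply/subset_leq_card/fintype.subsetP => k /imsetP[j].
    rewrite !inE => /andP[]; case Ej: exit_point => [[] i] //= _ /eqP oj ->.
    have /matched_sym ji : matched cfg h (true, j) (true, i) by exact/exit_pointP.
    rewrite (matched_odd_column M ji) oj eqxx andbT.
    by have /exit_pointP -> := ji.
  move=> i j; rewrite !inE => /andP[Ci _] /andP[Cj _] E.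
  suff : exit_point cfg h (true, i) = exit_point cfg h (true, j).
    by move/(can_inj (exit_pointK cfg h)) => -[].
  rewrite [LHS]surjective_pairing [RHS]surjective_pairing E.
  by move: Ci Cj; case: (exit_point _ _ _).1; case: (exit_point _ _ _).1.
have split_odd e' :
    (#|[set j in C | odd j == e']| + #|U e'|)%N = #|[set j : 'I_n | odd j == e']|.
  rewrite -(cardsID C [set j : 'I_n | odd j == e']); congr addn.
    by apply: eq_card => j; rewrite !inE andbC.
  by apply: eq_card => j; rewrite !inE.
have := split_odd e; have := split_odd (~~ e); rewrite -card_odd_columns.
have := leU e; have := leU (~~ e); rewrite negbK.
have : (#|[set j in C | odd j == e]| + #|[set j in C | odd j == ~~ e]|)%N = #|C|.
  rewrite -(cardsID [set j : 'I_n | odd j == e] C); congr addn.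
    by apply: eq_card => j; rewrite !inE.
  by apply: eq_card => j; rewrite !inE andbC; case: e; case: odd.
lia.
Qed.

End Manhattan.

(** * Words of streets and their probabilities *)

Section Words.
Variables (R : realType) (md : model) (n : nat) (p : R).

Local Notation row := {ffun 'I_n -> option orientation}.
Implicit Types (c : seq row) (r : row).

(** The rows of the word [c], from south to north, are the streets
    [s_1], ..., [s_(size c)]. *)
Definition strip_cfg c : configuration n := fun v =>
  match v.1 with
  | Posz t.+1 => nth [ffun=> None] c t v.2
  | _ => None
  end.

Definition survivors c : nat := #|crossing false (strip_cfg c) (size c)|.

Lemma strip_cfg_rcons_last c r i :
  strip_cfg (rcons c r) ((size c).+1%:Z, i) = r i.
Proof. by rewrite /strip_cfg /= nth_rcons ltnn eqxx. Qed.

Lemma strip_cfg_rcons c r v :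
  1 <= v.1 <= (size c)%:Z -> strip_cfg c v = strip_cfg (rcons c r) v.
Proof.
case: v => -[[|t]|t] i //= ht; rewrite /strip_cfg /= nth_rcons.
by rewrite (_ : (t < size c)%N) //; lia.
Qed.

Lemma crossing_rcons b c r :
  crossing b (strip_cfg (rcons c r)) (size c) =
  crossing b (strip_cfg c) (size c).
Proof. by apply/esym/eq_crossing => v; exact: strip_cfg_rcons. Qed.

Lemma survivors_rcons c r : (survivors (rcons c r) <= survivors c)%N.
Proof.
rewrite /survivors -(crossing_rcons _ c r) size_rcons.
exact/subset_leq_card/crossing_subset.
Qed.

Lemma survivors_nil : survivors [::] = n.
Proof.
rewrite /survivors -[RHS]card_ord; apply: eq_card => j; rewrite !inE.
suff /exit_pointP -> : matched (strip_cfg [::]) 0 (false, j) (true, j) by [].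
by exists 0%N; rewrite /ray_in /ray_out.
Qed.

Lemma survivors_leq c : (survivors c <= n)%N.
Proof. by rewrite -[X in (_ <= X)%N]card_ord max_card. Qed.

Lemma odd_survivors c : ~~ odd n -> ~~ odd (survivors c).
Proof.
by rewrite -{1}(num_bars_crossing (strip_cfg c) (size c)) oddD odd_double.
Qed.

Lemma card_tops c : #|crossing true (strip_cfg c) (size c)| = survivors c.
Proof. exact: card_crossing. Qed.

Lemma survivors_turn c r a b :
    a \in crossing true (strip_cfg c) (size c) ->
    b \in crossing true (strip_cfg c) (size c) -> a != b ->
    r a = Some NE -> r b = Some NW ->
    (forall i, (0 < dist a i < dist a b)%N -> r i = None) ->
  (survivors (rcons c r) < survivors c)%N.
Proof.
move=> Ca Cb neq ra rb ri; rewrite /survivors -(crossing_rcons _ c r) size_rcons.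
apply: (@crossing_turn _ _ _ a b); rewrite ?crossing_rcons //.
by split=> [|||i /ri]; rewrite ?strip_cfg_rcons_last.
Qed.

Lemma tops_keep c r a : a \in crossing true (strip_cfg c) (size c) ->
  r a = None -> a \in crossing true (strip_cfg (rcons c r)) (size (rcons c r)).
Proof.
move=> Ca ra; rewrite size_rcons; apply: crossing_keep.
  by rewrite crossing_rcons.
by rewrite strip_cfg_rcons_last.
Qed.

Definition law t i (m : mirror) : R := mirror_law md p ((t%:Z, i) : vertex n) m.
#[local] Arguments law : simpl never.

Definition row_weight t r : R := \prod_i law t i (r i).

Definition word_weight c : R :=
  \prod_(k < size c) row_weight k.+1 (nth [ffun=> None] c k).

Lemma word_weight_rcons c r :
  word_weight (rcons c r) = word_weight c * row_weight (size c).+1 r.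
Proof.
rewrite /word_weight size_rcons big_ord_recr /= nth_rcons ltnn eqxx.
by congr (_ * _); apply: eq_bigr => k _; rewrite nth_rcons ltn_ord.
Qed.

Definition row_prob t (A : pred row) : R := \sum_(r | A r) row_weight t r.

(** With [word_weight], a finite model of the law of the first [h] streets; [expect] is the mean in
    it. *)
Fixpoint words h : seq (seq row) :=
  if h is h'.+1 then [seq rcons c r | c <- words h', r <- enum {: row}]
  else [:: [::]].

Definition expect h (F : seq row -> R) : R :=
  \sum_(c <- words h) word_weight c * F c.

Lemma size_words h c : c \in words h -> size c = h.
Proof.
elim: h c => [|h IH] c /=; first by rewrite inE => /eqP ->.
by move=> /allpairsP[[c' r] /= [/IH <- _ ->]]; rewrite size_rcons.
Qed.

Lemma mem_words h c : size c = h -> c \in words h.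
Proof.
elim: h c => [|h IH] c /=; first by move/eqP/nilP ->.
case/lastP: c => // c r; rewrite size_rcons => -[/IH cw].
by apply/allpairsP; exists (c, r); rewrite mem_enum.
Qed.

Lemma words_uniq h : uniq (words h).
Proof.
elim: h => //= h IH; apply: allpairs_uniq => //; first exact: enum_uniq.
by move=> [c r] [c' r'] _ _ /rcons_inj[-> ->].
Qed.

Lemma expectS h F :
  expect h.+1 F =
  expect h (fun c => \sum_r row_weight h.+1 r * F (rcons c r)).
Proof.
rewrite /expect /= big_allpairs_dep big_seq [RHS]big_seq.
apply: eq_bigr => c /size_words cw; rewrite big_enum mulr_sumr.
by apply: eq_bigr => r _; rewrite word_weight_rcons cw mulrA.
Qed.

Lemma big_mirror (F : mirror -> R) (A : pred mirror) :
  \sum_(m | A m) F m = (if A None then F None else 0) +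
    (if A (Some NW) then F (Some NW) else 0) +
    (if A (Some NE) then F (Some NE) else 0).
Proof.
rewrite big_mkcond /= (bigD1 (None : option orientation)) //= -addrA.
congr (_ + _); rewrite (bigD1 (Some NW)) //=; congr (_ + _).
by rewrite (bigD1 (Some NE)) //= big1 ?addr0 // => -[[]|].
Qed.

Lemma law_sum t i : \sum_m law t i m = 1.
Proof.
rewrite big_mirror /law /mirror_law.
by case: md => /=; [|case: manhattan_orientation]; field.
Qed.

(** Independence within a street: a sum over rows of a product over vertices is a product of
    sums. *)
Lemma row_prob_family t (G : 'I_n -> pred mirror) :
  row_prob t [pred r : row | [forall i, G i (r i)]] =
  \prod_i \sum_(m | G i m) law t i m.
Proof.
rewrite bigA_distr_big_dep; apply: eq_bigl => r; rewrite inE.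
by apply: eq_forallb => i.
Qed.

Lemma row_weight_sum t : \sum_r row_weight t r = 1.
Proof.
rewrite /row_weight -(bigA_distr_bigA (fun i m => law t i m)).
by rewrite big1 // => i _; exact: law_sum.
Qed.

Hypotheses (p_ge0 : 0 <= p) (p_le1 : p <= 1).

Lemma law_ge0 t i m : 0 <= law t i m.
Proof.
rewrite /law /mirror_law; case: m => [m|]; last by rewrite subr_ge0.
by case: md => /=; [rewrite divr_ge0|case: manhattan_orientation; case: m].
Qed.

Lemma row_weight_ge0 t r : 0 <= row_weight t r.
Proof. by apply: prodr_ge0 => i _; exact: law_ge0. Qed.

Lemma word_weight_ge0 c : 0 <= word_weight c.
Proof. by apply: prodr_ge0 => k _; exact: row_weight_ge0. Qed.

Lemma row_prob_subset t (A B : pred row) :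
  (forall r, A r -> B r) -> row_prob t A <= row_prob t B.
Proof.
move=> AB; rewrite /row_prob [leLHS]big_mkcond [leRHS]big_mkcond /=.
apply: ler_sum => r _; case: ifP => [/AB -> //|_].
by case: ifP => // _; exact: row_weight_ge0.
Qed.

Lemma row_prob_ge0 t (A : pred row) : 0 <= row_prob t A.
Proof. by apply: sumr_ge0 => r _; exact: row_weight_ge0. Qed.

(** Restricting to words of non-zero weight lets the parity facts of the Manhattan model be used. *)
Lemma ler_expect h F G : (forall c, size c = h -> word_weight c != 0 -> F c <= G c) ->
  expect h F <= expect h G.
Proof.
move=> FG; rewrite /expect big_seq [leRHS]big_seq.
apply: ler_sum => c /size_words cw; have [->|nz] := eqVneq (word_weight c) 0.
  by rewrite !mul0r.
by rewrite ler_wpM2l ?word_weight_ge0 // FG.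
Qed.

Lemma expectZ h (x : R) F : expect h (fun c => x * F c) = x * expect h F.
Proof.
by rewrite /expect mulr_sumr; apply: eq_bigr => c _; rewrite mulrCA.
Qed.

(** The probability that [V_(n/2)] exceeds [h]. *)
Definition survival h : R := expect h (fun c => (0 < survivors c)%N%:R).

Lemma survivalS h : survival h.+1 <= survival h.
Proof.
rewrite /survival expectS; apply: ler_expect => c ch _.
rewrite -[leRHS]mul1r -[X in _ <= X * _](row_weight_sum h.+1) mulr_suml.
apply: ler_sum => r _; rewrite ler_wpM2l ?row_weight_ge0 //.
rewrite ler_nat; have := survivors_rcons c r.
by case: (survivors (rcons c r)) => // k /(leq_trans _) ->.
Qed.

Lemma survival_le h k : (h <= k)%N -> survival k <= survival h.
Proof.
move=> /subnK <-; elim: (k - h)%N => // m IH.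
exact: le_trans (survivalS _) IH.
Qed.

Lemma expect1 h : expect h (fun=> 1) = 1.
Proof.
elim: h => [|h IH].
  by rewrite /expect /= big_seq1 /word_weight big_ord0 mulr1.
rewrite expectS -[RHS]IH; congr expect; apply/funext => c.
by rewrite -[RHS](row_weight_sum h.+1); apply: eq_bigr => r _; rewrite mulr1.
Qed.

(** One street erases all the NS paths only if it has a mirror at the top of
    each of them, and there are at least two of them. *)
Lemma extinction_street c : ~~ odd n -> (0 < survivors c)%N ->
  row_prob (size c).+1 [pred r | survivors (rcons c r) == 0%N] <= p ^+ 2.
Proof.
move=> n_even c_gt0.
have : (1 < #|crossing true (strip_cfg c) (size c)|)%N.
  by rewrite card_tops; have := odd_survivors c n_even; case: survivors c_gt0 => [|[]].
case/card_gt1P => a [b [Ca Cb neq]].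
pose G i : pred mirror := fun m => if (i == a) || (i == b) then m != None else true.
apply: (@le_trans _ _ (row_prob (size c).+1 [pred r : row | [forall i, G i (r i)]])).
  apply: row_prob_subset => r /= /eqP r0; apply/forallP => i; rewrite /G.
  case: ifP => // iab; apply: contraTneq isT => ri.
  have Ci : i \in crossing true (strip_cfg c) (size c).
    by case/orP: iab => /eqP ->.
  have := tops_keep Ci ri; move/eqP: r0; rewrite -card_tops cards_eq0 => /eqP ->.
  by rewrite inE.
rewrite row_prob_family (bigD1 a) //= (bigD1 b) 1?eq_sym //= [X in _ * (_ * X)]big1 => [|i].
  rewrite /G !eqxx orbT /= mulr1 expr2.
  suff E i : \sum_(m : mirror | m != None) law (size c).+1 i m = p by rewrite !E.
  have := law_sum (size c).+1 i; rewrite (bigD1 None) //= {1}/law /=.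
  by move=> E; apply: (@addrI _ (1 - p)); rewrite E; ring.
by case/andP => /negbTE ia /negbTE ib; rewrite /G ia ib /= law_sum.
Qed.

(** A union bound over the street that destroys the last NS paths. *)
Lemma extinction_bound h : ~~ odd n -> (0 < n)%N ->
  1 - h%:R * p ^+ 2 <= survival h.
Proof.
move=> n_even n_gt0; elim: h => [|h IH].
  rewrite mul0r subr0 /survival /expect /= big_seq1 /word_weight big_ord0 mul1r.
  by rewrite survivors_nil n_gt0.
have : survival h - p ^+ 2 <= survival h.+1; last first.
  by move: IH; rewrite -natr1 mulrDl mul1r; lra.
rewrite {2}/survival expectS {1}/survival.
have E : p ^+ 2 = expect h (fun=> p ^+ 2 * 1) by rewrite expectZ expect1 mulr1.
rewrite [X in _ - X <= _]E /expect -sumrB.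
under eq_bigr do rewrite -mulrBr.
apply: ler_expect => c ch _ /=; rewrite mulr1.
case: (posnP (survivors c)) => [_|c_gt0].
  rewrite sub0r (@le_trans _ _ 0) ?oppr_le0 ?exprn_ge0 //.
  by apply: sumr_ge0 => r _; rewrite mulr_ge0 ?row_weight_ge0.
have := extinction_street n_even c_gt0; rewrite ch /row_prob => H.
rewrite lerBlDr; apply: le_trans (lerD (lexx _) H).
rewrite -[leLHS](row_weight_sum h.+1) [X in _ + X]big_mkcond -big_split /=.
apply: ler_sum => r _; case: (posnP (survivors (rcons c r))) => r_0.
  by rewrite mulr0 add0r.
by rewrite mulr1 addr0.
Qed.

End Words.

(** * The number of NS paths drops *)

Section DropProbability.
Variables (R : realType) (md : model) (n : nat) (p : R).
Hypotheses (p_ge0 : 0 <= p) (p_le1 : p <= 1) (n_even : ~~ odd n).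

Local Notation row := {ffun 'I_n -> option orientation}.
#[local] Arguments law : simpl never.
Local Notation law := (law md p).
Local Notation row_weight := (row_weight md p).
Local Notation row_prob := (row_prob md p).
Local Notation word_weight := (word_weight md p).
Implicit Types (c : seq row) (r : row) (a b i : 'I_n).

Local Notation tops c := (crossing true (strip_cfg c) (size c)).

(** The ordinal [i] stands for column [i + 1], so even ordinals are southbound. *)
Lemma manhattan_orientationE t i :
  manhattan_orientation ((t%:Z, i) : vertex n) =
  if odd i == odd t then NE else NW.
Proof.
rewrite /manhattan_orientation /column_direction /street_direction.
by rewrite /column_number /=; case: odd; case: odd.
Qed.

Lemma lawE t i m : law t i m =
  match m, md with
  | None, _ => 1 - p
  | Some _, Mir => p / 2
  | Some NE, Mat => if odd i == odd t then p else 0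
  | Some NW, Mat => if odd i == odd t then 0 else p
  end.
Proof.
rewrite /law /mirror_law manhattan_orientationE.
by case: m => [[]|] //; case: md => //; case: eqP.
Qed.

Lemma manhattan_word c : md = Mat -> word_weight c != 0 ->
  manhattan_strip (strip_cfg c) (size c).
Proof.
move=> mdE /prodf_neq0 nz [[[|t]|t] i] // ht.
have lt_t : (t < size c)%N by move: ht; rewrite /=; lia.
have /prodf_neq0 /(_ i isT) := nz (Ordinal lt_t) isT.
rewrite /law /mirror_law mdE /strip_cfg /=.
case: (nth [ffun=> None] c t i) => [m|]; last by move=> _; left.
by case: manhattan_orientation; case: m; rewrite ?eqxx; auto.
Qed.

Lemma card_odd_tops c (e : bool) : md = Mat -> word_weight c != 0 ->
  (#|[set j in tops c | odd j == e]|).*2 = survivors c.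
Proof.
by move=> mdE nz; rewrite card_odd_crossing ?card_tops //; exact: manhattan_word.
Qed.

Definition drop_prob c : R :=
  row_prob (size c).+1 [pred r | (survivors (rcons c r) < survivors c)%N].

Definition pair_row a b : row :=
  [ffun i => if i == a then Some NE else if i == b then Some NW else None].

Lemma pair_row_weight t a b : a != b ->
  row_weight t (pair_row a b) =
  law t a (Some NE) * law t b (Some NW) * (1 - p) ^+ (n - 2).
Proof.
move=> neq; rewrite /row_weight (bigD1 a) //= (bigD1 b) 1?eq_sym //= -mulrA.
rewrite !ffunE !eqxx eq_sym (negbTE neq); congr (_ * (_ * _)).
rewrite (eq_bigr (fun=> 1 - p)) => [|i /andP[/negbTE ia /negbTE ib]]; last first.
  by rewrite ffunE ia ib.
rewrite prodr_const; congr (_ ^+ _).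
rewrite -[in RHS](card_ord n) -(cardC (pred2 a b)) card2 neq addKn.
by apply: eq_card => i; rewrite !inE negb_or.
Qed.

(** Different ordered pairs give different rows [pair_row a b], and each of them joins two NS paths;
    hence their weights add up to at most the drop probability. *)
Lemma pairs_le_drop c (t := (size c).+1) :
  \sum_(a in tops c) \sum_(b in tops c | b != a)
    law t a (Some NE) * law t b (Some NW) * (1 - p) ^+ (n - 2) <= drop_prob c.
Proof.
rewrite pair_big_dep /=.
pose D := [set x : 'I_n * 'I_n | (x.1 \in tops c) && ((x.2 \in tops c) && (x.2 != x.1))].
have memD a b : ((a, b) \in D) = [&& a \in tops c, b \in tops c & b != a].
  by rewrite [LHS]inE.
rewrite (eq_bigl (fun x => x \in D)); last by move=> [a b]; rewrite memD.
rewrite (eq_bigr (fun x => row_weight t (pair_row x.1 x.2))); last first.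
  by move=> [a b]; rewrite memD eq_sym => /and3P[_ _ /pair_row_weight ->].
rewrite -(big_imset (row_weight t)) /=.
  apply: row_prob_subset => // r /imsetP[[a b]]; rewrite memD /=.
  move=> /and3P[Ta Tb]; rewrite eq_sym => neq ->.
  apply: (survivors_turn Ta Tb) => //; rewrite ?ffunE ?eqxx //.
  - by rewrite eq_sym (negbTE neq).
  - move=> i /andP[gt lt]; rewrite ffunE; case: eqP => [Ei|_].
      by move: gt; rewrite Ei /dist addKn modnn.
    by case: eqP => [Ei|//]; move: lt; rewrite Ei ltnn.
move=> [a b] [a' b']; rewrite !memD /= => /and3P[_ _ neq] /and3P[_ _ neq'].
move/ffunP => E; have := E a; rewrite !ffunE eqxx.
case: eqP => [-> _|_]; last by case: ifP.
have := E b; rewrite !ffunE eqxx (negbTE neq).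
by case: eqP => // _; case: eqP => [->|].
Qed.

(** Exactly two mirrors, facing each other, at two of the NS paths. *)
Lemma drop_prob_pairs c k : word_weight c != 0 -> survivors c = k.*2 ->
  (k * (k.*2).-1)%:R / 2 * p ^+ 2 * (1 - p) ^+ (n - 2) <= drop_prob c.
Proof.
move=> nz ck; apply: le_trans (pairs_le_drop c); set t := (size c).+1.
have y_ge0 : 0 <= (1 - p) ^+ (n - 2) by rewrite exprn_ge0 // subr_ge0.
under eq_bigr do rewrite -mulr_suml; rewrite -mulr_suml ler_wpM2r //.
have [mdE|mdE] : md = Mir \/ md = Mat by case: (md); [left|right].
  have card2 a : a \in tops c ->
    #|[pred b | (b \in tops c) && (b != a)]| = (k.*2).-1.
    move=> Ta; rewrite -ck -card_tops [in RHS](cardD1 a) Ta /=.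
    by apply: eq_card => b; rewrite !inE andbC.
  (* Lorentz: [2k (2k - 1)] ordered pairs of weight [p^2 / 4] each, which gives equality. *)
  rewrite (eq_bigr (fun=> (k.*2).-1%:R * (p ^+ 2 / 4))) => [|a Ta]; last first.
    rewrite (eq_bigr (fun=> p ^+ 2 / 4)) => [|b _].
      by rewrite sumr_const card2 // mulr_natl.
    by rewrite !lawE mdE; field.
  rewrite sumr_const card_tops ck -mulr_natl -mul2n !natrM.
  by rewrite le_eqVlt; apply/orP; left; apply/eqP; field.
(* Manhattan: [k] tops can carry [NE] and the other [k] can carry [NW], so the sum is [k^2 p^2]. The
   term [b = a], added to separate the two sums, vanishes because a vertex allows one orientation
   only. *)
rewrite (eq_bigr (fun a => (if odd a == odd t then p else 0) *
    \sum_(b in tops c) (if odd b == ~~ odd t then p else 0))); last first.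
  move=> a Ta; rewrite mulr_sumr [RHS](bigD1 a) //= -[LHS]add0r.
  congr (_ + _).
    by case: (odd a); case: (odd (size c)); rewrite ?mul0r ?mulr0.
  apply: eq_bigr => b _; rewrite !lawE mdE /=.
  by case: (odd a); case: (odd b); case: (odd (size c)).
rewrite -mulr_suml.
have sum_p e : \sum_(b in tops c) (if odd b == e then p else 0) = k%:R * p.
  rewrite -big_mkcondr /= sumr_const mulr_natl; congr (_ *+ _).
  apply: double_inj; rewrite -ck -(card_odd_tops e mdE nz); congr double.
  by apply: eq_card => b; rewrite [RHS]inE.
rewrite !sum_p.
have : (k * (k.*2).-1)%:R <= 2 * k%:R * k%:R :> R.
  by rewrite -!natrM ler_nat; nia.
by have := sqr_ge0 p; nra.
Qed.

(** Unlike for [pair_row], the mirrors outside the eastward arc from [a] to [b] are left free. *)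
Definition turn_rows a b : pred row := fun r =>
  [forall i, if i == a then r i == Some NE else if i == b then r i == Some NW
             else (dist a i < dist a b)%N ==> (r i == None)].

Lemma turn_rows_drop c r a b : a \in tops c -> b \in tops c -> a != b ->
  turn_rows a b r -> (survivors (rcons c r) < survivors c)%N.
Proof.
move=> Ta Tb neq /forallP H; apply: (survivors_turn Ta Tb neq).
- by have := H a; rewrite eqxx => /eqP.
- by have := H b; rewrite eq_sym (negbTE neq) eqxx => /eqP.
move=> i /andP[gt lt]; have := H i; rewrite lt; case: eqP => [Ei|_].
  by move: gt; rewrite Ei /dist addKn modnn.
by case: eqP => [Ei|_ /eqP //]; move: lt; rewrite Ei ltnn.
Qed.

(** At most [dist a b - 1] vertices lie strictly inside the arc, each of them open with probability
    [1 - p]. *)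
Lemma turn_rows_prob t a b : a != b ->
  law t a (Some NE) * law t b (Some NW) * (1 - p) ^+ (dist a b).-1 <=
  row_prob t (turn_rows a b).
Proof.
move=> neq.
pose G i : pred mirror := fun m =>
  if i == a then m == Some NE else if i == b then m == Some NW
  else (dist a i < dist a b)%N ==> (m == None).
have -> : row_prob t (turn_rows a b) =
    row_prob t [pred r : row | [forall i, G i (r i)]].
  by [].
rewrite row_prob_family (bigD1 a) //= (bigD1 b) 1?eq_sym //= mulrA.
have sum1 m0 i : \sum_(m | m == m0) law t i m = law t i m0 by rewrite big_pred1_eq.
rewrite /G eqxx eq_sym (negbTE neq) eqxx !sum1.
rewrite ler_wpM2l ?mulr_ge0 ?law_ge0 //.
rewrite (eq_bigr (fun i => if (dist a i < dist a b)%N then 1 - p else 1)); last first.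
  move=> i /andP[/negbTE -> /negbTE ->]; case: ltnP => _ /=; last exact: law_sum.
  by rewrite sum1 lawE.
rewrite -big_mkcondr /= prodr_const ler_wiXn2l ?subr_ge0 ?gerBl //.
pose f (k : 'I_(dist a b).-1) := iter k.+1 (@ordS n) a.
apply: leq_trans (_ : #|[seq f k | k : 'I_(dist a b).-1]| <= _)%N; last first.
  by rewrite (leq_trans (leq_image_card _ _)) // card_ord.
apply/subset_leq_card/fintype.subsetP => i /andP[/andP[ia ib] lt].
have gt : (0 < dist a i)%N by apply: dist_gt0; rewrite eq_sym.
have lt' : ((dist a i).-1 < (dist a b).-1)%N by lia.
apply/fintype.imageP; exists (Ordinal lt') => //.
by rewrite /f /= -iterS prednK // iter_ordS_dist.
Qed.

End DropProbability.

(** * Turning along the shorter arc, within one or two streets *)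

Section TwoStreets.
Variables (R : realType) (md : model) (n : nat) (p : R).
Hypotheses (p_ge0 : 0 <= p) (p_le1 : p <= 1) (n_even : ~~ odd n).

#[local] Arguments law : simpl never.
Local Notation row := {ffun 'I_n -> option orientation}.
Local Notation law := (law md p).
Local Notation row_weight := (row_weight md p).
Local Notation row_prob := (row_prob md p).
Local Notation word_weight := (word_weight md p).
Local Notation drop_prob := (drop_prob md p).
Implicit Types (c : seq row) (r : row) (a b i : 'I_n).

Local Notation tops c := (crossing true (strip_cfg c) (size c)).

Lemma row_prob_disjoint t (A B C : pred row) :
    (forall r, A r -> C r) -> (forall r, B r -> C r) ->
    (forall r, A r -> ~~ B r) ->
  row_prob t A + row_prob t B <= row_prob t C.
Proof.
move=> AC BC AB; rewrite /row_prob [X in X + _]big_mkcond [X in _ + X]big_mkcond.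
rewrite -big_split [leRHS]big_mkcond /=; apply: ler_sum => r _.
have := row_weight_ge0 md p_ge0 p_le1 t r.
case: ifP => [Ar|_]; first by rewrite (negbTE (AB r Ar)) AC // addr0.
by rewrite add0r; case: ifP => [/BC -> //|_]; case: ifP.
Qed.

(** The inequality of arithmetic and geometric means for two powers of [y]. *)
Lemma exprn_mean (y : R) u v m : 0 <= y -> (u + v = m.*2)%N ->
  2 * y ^+ m <= y ^+ u + y ^+ v.
Proof.
move=> y0; wlog le_uv : u v / (u <= v)%N => [H|E].
  by case: (leqP u v) => [|/ltnW] /H {}H E; [|rewrite addrC]; apply: H; lia.
have -> : (m = u + (m - u))%N by lia.
have -> : (v = u + (m - u) + (m - u))%N by lia.
rewrite !exprD; set x := y ^+ u; set z := y ^+ _.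
have x0 : 0 <= x by exact: exprn_ge0.
have -> : x + x * z * z = 2 * (x * z) + x * (1 - z) ^+ 2 by ring.
by rewrite lerDl mulr_ge0 ?sqr_ge0.
Qed.

(** The two arcs between two NS paths cannot both be long, so one of the two
    ways of facing each other is cheap. *)
Lemma drop_prob_arcs c : md = Mir -> (0 < survivors c)%N ->
  p ^+ 2 / 2 * (1 - p) ^+ (n./2).-1 <= drop_prob c.
Proof.
move=> mdE c_gt0.
have : (1 < #|tops c|)%N.
  by rewrite card_tops; have := odd_survivors c n_even; case: survivors c_gt0 => [|[]].
case/card_gt1P => a [b [Ta Tb neq]].
have neq' : b != a by rewrite eq_sym.
set t := (size c).+1.
have ab := turn_rows_prob md p_ge0 p_le1 n_even t neq.
have ba := turn_rows_prob md p_ge0 p_le1 n_even t neq'.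
have : row_prob t (turn_rows a b) + row_prob t (turn_rows b a) <= drop_prob c.
  apply: row_prob_disjoint => r; try exact: turn_rows_drop.
  move=> /forallP /(_ a); rewrite eqxx => /eqP ra; apply/negP.
  by move=> /forallP /(_ a); rewrite eqxx (negbTE neq) ra.
apply: le_trans; apply: le_trans (lerD ab ba).
rewrite !lawE mdE -!mulrDr.
have -> : p / 2 * (p / 2) = p ^+ 2 / 4 by field.
(* The interiors of the two arcs have [n - 2] vertices together, so the mean exponent is
   [n/2 - 1]. *)
have : 2 * (1 - p) ^+ (n./2).-1 <=
    (1 - p) ^+ (dist a b).-1 + (1 - p) ^+ (dist b a).-1.
  apply: exprn_mean; first by rewrite subr_ge0.
  have := distC neq; have := dist_gt0 neq; have := dist_gt0 neq'.
  by have := odd_double_half n; rewrite (negbTE n_even); lia.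
by have := sqr_ge0 p; nra.
Qed.

Definition drop_prob2 c : R :=
  \sum_r1 row_weight (size c).+1 r1 * row_prob (size c).+2
    [pred r2 | (survivors (rcons (rcons c r1) r2) < survivors c)%N].

Lemma drop_prob2_ge c : drop_prob c <= drop_prob2 c.
Proof.
rewrite /drop_prob /row_prob big_mkcond; apply: ler_sum => r1 _ /=.
have w0 := row_weight_ge0 md p_ge0 p_le1.
case: ifP => lt; last by rewrite mulr_ge0 ?row_prob_ge0.
rewrite -[leLHS]mulr1 ler_wpM2l // -(row_weight_sum md n p (size c).+2).
apply: row_prob_subset => // r2 _ /=.
exact: leq_ltn_trans (survivors_rcons _ _) lt.
Qed.

(** The Manhattan lattice turns a northbound path towards a given southbound
    one in every second street only; if the short way round is not the one
    offered by the first street, then it is the one offered by the second. *)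
Lemma drop_prob2_arcs c : md = Mat -> word_weight c != 0 ->
  (0 < survivors c)%N -> p ^+ 2 * (1 - p) ^+ (n./2).+1 <= drop_prob2 c.
Proof.
move=> mdE nz c_gt0; set h := size c.
have top e : exists2 a, a \in tops c & odd a = e.
  have : (0 < #|[set j in tops c | odd j == e]|)%N.
    by have := card_odd_tops p_ge0 p_le1 n_even e mdE nz; lia.
  by case/card_gt0P => a; rewrite finset.in_set => /andP[Ta /eqP]; exists a.
(* In street [h + 1] the columns of the parity of [h + 1] admit [NE] and the others [NW]; in street
   [h + 2] it is the reverse. So the first street can turn light from [a] to [b], the second from
   [b] to [a]. *)
have [a Ta oa] := top (~~ odd h); have [b Tb ob] := top (odd h).
have neq : a != b.
  by apply: contraTneq isT => ab; move: oa; rewrite ab ob; case: odd.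
have neq' : b != a by rewrite eq_sym.
have n2 := odd_double_half n; rewrite (negbTE n_even) add0n in n2.
have y0 : 0 <= 1 - p by rewrite subr_ge0.
have y1 : 1 - p <= 1 by rewrite gerBl.
have [short|long] := leqP (dist a b).-1 (n./2).-1.
  apply: le_trans (drop_prob2_ge c).
  apply: le_trans (_ : _ <= row_prob h.+1 (turn_rows a b)) _; last first.
    by apply: row_prob_subset => // r; exact: turn_rows_drop.
  apply: le_trans (turn_rows_prob md p_ge0 p_le1 n_even _ neq).
  have le_short : ((dist a b).-1 <= (n./2).+1)%N by move: short; clear; lia.
  rewrite !lawE mdE oa ob /= eqxx; case: (odd h) => /=;
    by rewrite -expr2 ler_wpM2l ?sqr_ge0 // ler_wiXn2l.
(* The arc from [a] to [b] is long: both tops are carried through street [h + 1], with probability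
   [(1 - p)^2], and street [h + 2] uses the other arc. *)
pose G i : pred mirror := fun m => if (i == a) || (i == b) then m == None else true.
have open_prob : row_prob h.+1 [pred r : row | [forall i, G i (r i)]] = (1 - p) ^+ 2.
  rewrite row_prob_family (bigD1 a) //= (bigD1 b) 1?eq_sym //=.
  rewrite [X in _ * (_ * X)]big1 => [|i /andP[/negbTE ia /negbTE ib]]; last first.
    by rewrite /G ia ib /= law_sum.
  by rewrite /G !eqxx orbT /= !big_pred1_eq !lawE mulr1.
apply: (@le_trans _ _ ((1 - p) ^+ 2 * row_prob h.+2 (turn_rows b a))).
  apply: le_trans (_ : (1 - p) ^+ 2 * (p ^+ 2 * (1 - p) ^+ (dist b a).-1) <= _).
    rewrite mulrCA ler_wpM2l ?sqr_ge0 // -exprD ler_wiXn2l //.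
    by move: long (distC neq) (dist_gt0 neq) n2; clear; lia.
  rewrite ler_wpM2l ?sqr_ge0 //.
  apply: le_trans (turn_rows_prob md p_ge0 p_le1 n_even _ neq').
  by rewrite !lawE mdE oa ob /= negbK eqxx expr2; case: (odd h).
rewrite -open_prob {1}/row_prob big_mkcond mulr_suml.
apply: ler_sum => r1 _.
have w0 := row_weight_ge0 md p_ge0 p_le1.
case: ifP => /= [/forallP Gr|_]; last by rewrite mul0r mulr_ge0 ?row_prob_ge0.
rewrite ler_wpM2l //; apply: row_prob_subset => // r2 /= tr.
apply: leq_trans (survivors_rcons c r1).
apply: (turn_rows_drop _ _ neq' tr); apply: tops_keep => //.
  by have := Gr b; rewrite /G eqxx orbT => /eqP.
by have := Gr a; rewrite /G eqxx => /eqP.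
Qed.

End TwoStreets.

(** * The probability that two streets contain a closed wall *)

Section WallProbability.
Variables (R : realType) (md : model) (n : nat) (p : R).
Hypotheses (p_ge0 : 0 <= p) (p_le1 : p <= 1) (n_even : ~~ odd n).

#[local] Arguments law : simpl never.
Local Notation row := {ffun 'I_n -> option orientation}.
Local Notation law := (law md p).
Local Notation row_weight := (row_weight md p).
Local Notation row_prob := (row_prob md p).
Implicit Types (c : seq row) (r : row) (i : 'I_n).

Definition extinction_prob2 c : R :=
  \sum_r1 row_weight (size c).+1 r1 * row_prob (size c).+2
    [pred r2 | survivors (rcons (rcons c r1) r2) == 0%N].

Definition lower_mirror (e : bool) : mirror := Some (if e then NE else NW).
Definition upper_mirror (e : bool) : mirror := Some (if e then NW else NE).

Definition wall_rows r1 r2 : bool :=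
  [forall i : 'I_n, [forall j : 'I_n, (i./2 == j./2) ==> (r1 j == lower_mirror (odd j))]
          || [forall j : 'I_n, (i./2 == j./2) ==> (r2 j == upper_mirror (odd j))]].

Lemma survivors_wall c r1 r2 : wall_rows r1 r2 ->
  survivors (rcons (rcons c r1) r2) = 0%N.
Proof.
move=> /forallP W; rewrite /survivors !size_rcons.
pose up : pred nat := fun b =>
  [forall j : 'I_n, (b == j./2) ==> (r2 j == upper_mirror (odd j))].
apply: (crossing_wall n_even (up := up)) => i.
have E2 : strip_cfg (rcons (rcons c r1) r2) ((size c).+2%:Z, i) = r2 i.
  by rewrite -(strip_cfg_rcons_last (rcons c r1)) size_rcons.
have E1 : strip_cfg (rcons (rcons c r1) r2) ((size c).+1%:Z, i) = r1 i.
  rewrite -strip_cfg_rcons ?strip_cfg_rcons_last // size_rcons /=; lia.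
rewrite E1 E2; have := W i; rewrite /up; case: ifP => [/forallP/(_ i) H _|_].
  by move: H; rewrite eqxx => /eqP.
by rewrite orbF => /forallP/(_ i); rewrite eqxx => /eqP.
Qed.

Let k := n./2.

Lemma half_ord_subproof i : (i./2 < k)%N.
Proof.
have := ltn_ord i; have := odd_double_half n.
by rewrite (negbTE n_even) /k; lia.
Qed.

Definition block i : 'I_k := Ordinal (half_ord_subproof i).

Lemma block_column_subproof (e : bool) (b : 'I_k) : (e + b.*2 < n)%N.
Proof.
have := ltn_ord b; have := odd_double_half n.
by rewrite (negbTE n_even) /k; case: e; lia.
Qed.

Definition block_column e b : 'I_n := Ordinal (block_column_subproof e b).

Lemma block_block_column e b : block (block_column e b) = b.
Proof. by apply/val_inj; rewrite /= half_bit_double. Qed.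

Lemma odd_block_column e b : odd (block_column e b) = e.
Proof. by rewrite /= oddD odd_double addbF; case: e. Qed.

Lemma block_columnK i : block_column (odd i) (block i) = i.
Proof. by apply/val_inj; rewrite /= odd_double_half. Qed.

Lemma prod_blocks (F : 'I_n -> R) :
  \prod_i F i = \prod_b (F (block_column false b) * F (block_column true b)).
Proof.
rewrite (partition_big block predT) //=; apply: eq_bigr => b _.
rewrite (bigD1 (block_column false b)) ?block_block_column //=.
rewrite (bigD1 (block_column true b)) /=; last first.
  by rewrite block_block_column eqxx -val_eqE /= neq_ltn ltnS leqnn orbT.
rewrite big1 ?mulr1 // => i /andP[/andP[/eqP ib n0] n1].
have := block_columnK i; rewrite ib.
by case: odd => E; [move: n1|move: n0]; rewrite E eqxx.
Qed.

Local Notation mirror4 :=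
  ((option orientation * option orientation) *
   (option orientation * option orientation))%type.

(** Two streets are regrouped into [n/2] blocks of four vertices; in each block the first component
    is the pair of the lower street. *)
Definition lower_row (f : {ffun 'I_k -> mirror4}) : row :=
  [ffun i : 'I_n => if odd i then (f (block i)).1.2 else (f (block i)).1.1].

Definition upper_row (f : {ffun 'I_k -> mirror4}) : row :=
  [ffun i : 'I_n => if odd i then (f (block i)).2.2 else (f (block i)).2.1].

Definition block_ok (m : mirror4) : bool :=
  (m.1 == (lower_mirror false, lower_mirror true)) ||
  (m.2 == (upper_mirror false, upper_mirror true)).

Lemma wall_rows_of_blocks (f : {ffun 'I_k -> mirror4}) : (forall b, block_ok (f b)) ->
  wall_rows (lower_row f) (upper_row f).
Proof.
move=> ok; apply/forallP => i; have /orP[/eqP E|/eqP E] := ok (block i).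
  apply/orP; left; apply/forallP => j; apply/implyP => /eqP ij.
  have bj : block j = block i by apply/val_inj.
  by rewrite ffunE bj E; case: odd.
apply/orP; right; apply/forallP => j; apply/implyP => /eqP ij.
have bj : block j = block i by apply/val_inj.
by rewrite ffunE bj E; case: odd.
Qed.

Lemma rows_of_blocks_inj : injective (fun f => (lower_row f, upper_row f)).
Proof.
move=> f g [/ffunP E1 /ffunP E2]; apply/ffunP => b.
have := E1 (block_column false b); have := E1 (block_column true b).
have := E2 (block_column false b); have := E2 (block_column true b).
rewrite !ffunE !odd_block_column !block_block_column.
by case: (f b) => [[? ?] [? ?]]; case: (g b) => [[? ?] [? ?]] /= -> -> -> ->.
Qed.

Definition block_weight t (b : 'I_k) (m : mirror4) : R :=
  law t (block_column false b) m.1.1 * law t (block_column true b) m.1.2 *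
  (law t.+1 (block_column false b) m.2.1 * law t.+1 (block_column true b) m.2.2).

Lemma row_weight_blocks t f :
  row_weight t (lower_row f) * row_weight t.+1 (upper_row f) =
  \prod_b block_weight t b (f b).
Proof.
rewrite /row_weight !prod_blocks -big_split; apply: eq_bigr => b _ /=.
by rewrite !ffunE !odd_block_column !block_block_column.
Qed.

(** The blocks are independent, and if all of them are good they form a wall. Expanding the product
    gives a sum over block assignments, which correspond injectively to pairs of streets. *)
Lemma extinction_prob2_blocks c :
  \prod_b \sum_(m | block_ok m) block_weight (size c).+1 b m <=
  extinction_prob2 c.
Proof.
set t := (size c).+1; rewrite bigA_distr_big_dep.
under eq_bigr do rewrite -row_weight_blocks.
rewrite /extinction_prob2.
have -> : \sum_r1 row_weight t r1 * row_prob t.+1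
      [pred r2 | survivors (rcons (rcons c r1) r2) == 0%N] =
    \sum_(x : row * row | survivors (rcons (rcons c x.1) x.2) == 0%N)
      row_weight t x.1 * row_weight t.+1 x.2.
  rewrite -(pair_big_dep xpredT
    (fun r1 r2 => survivors (rcons (rcons c r1) r2) == 0%N)
    (fun r1 r2 => row_weight t r1 * row_weight t.+1 r2)) /=.
  by apply: eq_bigr => r1 _; rewrite /row_prob mulr_sumr.
pose D := [set f : {ffun 'I_k -> mirror4} | [forall b, block_ok (f b)]].
rewrite (eq_bigl (fun f => f \in D)); last first.
  by move=> f; rewrite [RHS]inE; apply: eq_forallb.
have -> : \sum_(f in D) row_weight t (lower_row f) * row_weight t.+1 (upper_row f) =
    \sum_(x in [set (lower_row f, upper_row f) | f in D])
      row_weight t x.1 * row_weight t.+1 x.2.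
  by rewrite big_imset //= => f g _ _; exact: rows_of_blocks_inj.
rewrite [leLHS]big_mkcond [leRHS]big_mkcond; apply: ler_sum => -[r1 r2] _ /=.
have w0 := row_weight_ge0 md p_ge0 p_le1.
case: ifP => [/imsetP[f]|_]; last by case: ifP => // _; rewrite mulr_ge0.
rewrite inE => /forallP ok [-> ->].
by rewrite survivors_wall //; exact: wall_rows_of_blocks.
Qed.

(** The probability of a union of two independent events. *)
Lemma sum_or (I J : finType) (F : I -> R) (G : J -> R) (i0 : I) (j0 : J) :
    \sum_i F i = 1 -> \sum_j G j = 1 ->
  \sum_(x : I * J | (x.1 == i0) || (x.2 == j0)) F x.1 * G x.2 =
  F i0 + (1 - F i0) * G j0.
Proof.
move=> F1 G1.
rewrite -(pair_big_dep xpredT (fun x y => (x == i0) || (y == j0))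
  (fun x y => F x * G y)) /=.
rewrite (bigD1 i0) //= eqxx -mulr_sumr G1 mulr1; congr (_ + _).
rewrite (eq_bigr (fun x => F x * G j0)) => [|x /negbTE ->]; last first.
  by rewrite big_pred1_eq.
rewrite -mulr_suml; congr (_ * _); move: F1; rewrite (bigD1 i0) //= => <-.
by rewrite addrAC subrr add0r.
Qed.

Definition mirror_prob : R := if md is Mir then p / 2 else p.

(** In the Manhattan model the wall agrees with the prescribed orientations only if its lower street
    is odd. Each half of a block is right with probability [mirror_prob ^+ 2]. *)
Lemma block_weight_sum t b : odd t ->
  \sum_(m | block_ok m) block_weight t b m =
  2 * mirror_prob ^+ 2 - mirror_prob ^+ 4.
Proof.
move=> ot; rewrite /block_weight /block_ok.
have sum2 t' i j : \sum_(x : option orientation * option orientation)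
    law t' i x.1 * law t' j x.2 = 1.
  rewrite -(pair_big xpredT xpredT (fun x y => law t' i x * law t' j y)) /=.
  by under eq_bigr do rewrite -mulr_sumr law_sum mulr1; exact: law_sum.
rewrite (sum_or (F := fun x => law t (block_column false b) x.1 *
    law t (block_column true b) x.2)
  (G := fun x => law t.+1 (block_column false b) x.1 *
    law t.+1 (block_column true b) x.2)) //=.
rewrite !lawE !odd_block_column /= ot /= /mirror_prob.
by case: md; field.
Qed.

Lemma extinction_prob2_wall c : ~~ odd (size c) ->
  (2 * mirror_prob ^+ 2 - mirror_prob ^+ 4) ^+ n./2 <= extinction_prob2 c.
Proof.
move=> ec; apply: le_trans (extinction_prob2_blocks c).
under eq_bigr do rewrite block_weight_sum //.
by rewrite prodr_const card_ord.
Qed.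

End WallProbability.

(** * Exponential decay *)

Section Potential.
Variable R : realType.

(** Each drop from [k] lowers the potential by at least [4 * x k./2]; as the
    potential is at most 4, a drop probability [q] with [tau <= x k./2 * q]
    lowers its mean by the factor [1 - tau]. *)
Definition potential (x : nat -> R) (k : nat) : R :=
  if k == 0%N then 0 else 1 + 4 * \sum_(j < k./2) x j.+1.

Variables (x : nat -> R) (N : nat).
Hypotheses (x_ge0 : forall j, 0 <= x j) (x_sum : \sum_(j < N) x j.+1 <= 3 / 4).

Let x_partial a b : (a <= b)%N -> \sum_(j < a) x j.+1 <= \sum_(j < b) x j.+1.
Proof.
move=> ab; rewrite -(subnKC ab) big_split_ord /= lerDl.
by apply: sumr_ge0 => j _.
Qed.

Lemma potential_le a b : (a <= b)%N -> potential x a <= potential x b.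
Proof.
rewrite /potential => ab; have s_ge0 c : 0 <= \sum_(j < c) x j.+1.
  by apply: sumr_ge0 => j _.
case: eqP => [_|/eqP a0]; first by case: ifP => // _; have := s_ge0 b./2; lra.
case: eqP => [b0|_]; first by lia.
by rewrite lerD2l ler_wpM2l // x_partial // half_leq.
Qed.

Lemma potential_le4 k : (k <= N.*2)%N -> potential x k <= 4.
Proof.
rewrite /potential; case: ifP => // _ kN.
have := @x_partial k./2 N; have := x_sum; rewrite -(doubleK N) half_leq //.
by rewrite doubleK => H1 /(_ isT); lra.
Qed.

Lemma potential_gt0 k : (0 < k)%N%:R <= potential x k.
Proof.
rewrite /potential; case: k => // k /=.
have : 0 <= \sum_(j < uphalf k) x j.+1 by apply: sumr_ge0 => j _.
lra.
Qed.

Lemma potential_drop a k : (a < k)%N -> ~~ odd k ->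
  potential x a + 4 * x k./2 <= potential x k.
Proof.
move=> ak ek; have k0 : (0 < k./2)%N by have := odd_double_half k; lia.
apply: (@le_trans _ _ (1 + 4 * \sum_(j < (k./2).-1) x j.+1 + 4 * x k./2)).
  rewrite lerD2r /potential; case: eqP => [_|_].
    have : 0 <= \sum_(j < (k./2).-1) x j.+1 by apply: sumr_ge0 => j _.
    lra.
  rewrite lerD2l ler_wpM2l // x_partial //.
  by have := odd_double_half k; have := odd_double_half a; case: odd; lia.
rewrite /potential; case: eqP => [k00|_]; first by rewrite k00 in ak.
by case: (k./2) k0 => // m _; rewrite big_ord_recr /= mulrDr addrA.
Qed.

Lemma potential_step (I : finType) (w : I -> R) (kappa : I -> nat) k (tau : R) :
    (forall i, 0 <= w i) -> \sum_i w i = 1 -> (forall i, (kappa i <= k)%N) ->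
    ~~ odd k -> (k <= N.*2)%N -> 0 <= tau ->
    ((0 < k)%N -> tau <= x k./2 * \sum_(i | (kappa i < k)%N) w i) ->
  \sum_i w i * potential x (kappa i) <= (1 - tau) * potential x k.
Proof.
move=> w0 w1 kk ek kN tau0 drop.
case: (posnP k) => [k0|k_gt0].
  rewrite k0 {2}/potential eqxx mulr0 big1 // => i _.
  by have := kk i; rewrite k0 leqn0 => /eqP ->; rewrite /potential eqxx mulr0.
have H i : w i * potential x (kappa i) <=
    w i * potential x k - 4 * x k./2 * (if (kappa i < k)%N then w i else 0).
  case: ifP => lt; last by rewrite mulr0 subr0 ler_wpM2l // potential_le.
  rewrite mulrC [_ * x _ * _]mulrC -mulrBr mulrC ler_wpM2l //.
  by rewrite lerBrDr potential_drop.
apply: le_trans (ler_sum _ (fun i _ => H i)) _.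
rewrite sumrB -mulr_suml w1 mul1r -mulr_sumr -big_mkcond /=.
(* The mean loss is at least [4 * tau], and this is at least [tau] times the potential because the
   latter is at most [4]. *)
have := drop k_gt0; have := potential_le4 kN; nra.
Qed.

End Potential.

Section Decay.
Variables (R : realType) (md : model) (n : nat) (p : R).
Hypotheses (p_ge0 : 0 <= p) (p_le1 : p <= 1) (n_even : ~~ odd n).

Local Notation row := {ffun 'I_n -> option orientation}.
Local Notation row_weight := (row_weight md p).
Local Notation word_weight := (word_weight md p).
Local Notation survival := (survival md n p).
Implicit Types (c : seq row).

Let n_half : n = (n./2).*2.
Proof. by rewrite -[LHS]odd_double_half (negbTE n_even). Qed.

Let survival_expect (phi : nat -> R) h : (forall k, (0 < k)%N%:R <= phi k) ->
  survival h <= expect md p h (fun c => phi (survivors c)).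
Proof. by move=> Hphi; apply: ler_expect. Qed.

Let expect0 (phi : nat -> R) :
  expect md p 0 (fun c => phi (survivors c)) = phi n.
Proof.
by rewrite /expect /= big_seq1 /word_weight big_ord0 mul1r survivors_nil.
Qed.

(** A supermartingale bound: [phi] dominates the indicator of survival and its mean shrinks by
    [lambda] in each street. *)
Lemma survival_decay (phi : nat -> R) (lambda : R) h : 0 <= lambda ->
    (forall k, (0 < k)%N%:R <= phi k) ->
    (forall c, word_weight c != 0 ->
       \sum_r row_weight (size c).+1 r * phi (survivors (rcons c r)) <=
       lambda * phi (survivors c)) ->
  survival h <= lambda ^+ h * phi n.
Proof.
move=> l0 Hphi step; apply: le_trans (survival_expect _ Hphi) _.
elim: h => [|h IH]; first by rewrite expect0 mul1r.
rewrite expectS exprS -mulrA; apply: le_trans (ler_wpM2l l0 IH).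
rewrite -expectZ; apply: ler_expect => // c ch nz.
by rewrite -ch; exact: step.
Qed.

(** Blocks of two streets begin after an even number of streets; this parity is passed on for the
    sake of the walls. *)
Lemma survival_decay2 (phi : nat -> R) (lambda : R) h : 0 <= lambda ->
    (forall k, (0 < k)%N%:R <= phi k) ->
    (forall c, ~~ odd (size c) -> word_weight c != 0 ->
       \sum_r1 row_weight (size c).+1 r1 * \sum_r2 row_weight (size c).+2 r2 *
         phi (survivors (rcons (rcons c r1) r2)) <=
       lambda * phi (survivors c)) ->
  survival h.*2 <= lambda ^+ h * phi n.
Proof.
move=> l0 Hphi step; apply: le_trans (survival_expect _ Hphi) _.
elim: h => [|h IH]; first by rewrite expect0 mul1r.
rewrite doubleS !expectS exprS -mulrA; apply: le_trans (ler_wpM2l l0 IH).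
rewrite -expectZ; apply: ler_expect => // c ch nz.
by have := step c; rewrite ch odd_double => /(_ isT nz).
Qed.

Lemma survival_drop (x : nat -> R) (tau : R) h :
    (forall j, 0 <= x j) -> \sum_(j < n./2) x j.+1 <= 3 / 4 -> 0 <= tau <= 1 ->
    (forall c, word_weight c != 0 -> (0 < survivors c)%N ->
       tau <= x (survivors c)./2 * drop_prob md p c) ->
  survival h <= 4 * (1 - tau) ^+ h.
Proof.
move=> x0 xs /andP[tau0 tau1] drop; rewrite mulrC.
apply: le_trans (@survival_decay (potential x) (1 - tau) h _ _ _) _.
- by rewrite subr_ge0.
- by move=> k; exact: potential_gt0.
- move=> c nz; apply: (potential_step x0 xs) => //.
  + by move=> r; exact: row_weight_ge0.
  + exact: row_weight_sum.
  + by move=> r; exact: survivors_rcons.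
  + exact: odd_survivors.
  + by rewrite -n_half survivors_leq.
  + by move=> c0; exact: drop.
- rewrite ler_wpM2l ?exprn_ge0 ?subr_ge0 //.
  by apply: (potential_le4 x0 xs); rewrite -n_half.
Qed.

Lemma survival_drop2 (x : nat -> R) (tau : R) h :
    (forall j, 0 <= x j) -> \sum_(j < n./2) x j.+1 <= 3 / 4 -> 0 <= tau <= 1 ->
    (forall c, word_weight c != 0 -> (0 < survivors c)%N ->
       tau <= x (survivors c)./2 * drop_prob2 md p c) ->
  survival h.*2 <= 4 * (1 - tau) ^+ h.
Proof.
move=> x0 xs /andP[tau0 tau1] drop; rewrite mulrC.
apply: le_trans (@survival_decay2 (potential x) (1 - tau) h _ _ _) _.
- by rewrite subr_ge0.
- by move=> k; exact: potential_gt0.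
- move=> c _ nz.
  (* Pairs of rows serve as the index type, so that [potential_step] applies to a block of two
     streets at once. *)
  pose w (y : row * row) := row_weight (size c).+1 y.1 * row_weight (size c).+2 y.2.
  have pairE (A : row -> row -> bool) (F : row -> row -> R) :
      \sum_(y : row * row | A y.1 y.2) w y * F y.1 y.2 =
      \sum_r1 row_weight (size c).+1 r1 *
        \sum_(r2 | A r1 r2) row_weight (size c).+2 r2 * F r1 r2.
    rewrite -(pair_big_dep xpredT A (fun r1 r2 => w (r1, r2) * F r1 r2)) /=.
    apply: eq_bigr => r1 _; rewrite mulr_sumr; apply: eq_bigr => r2 _.
    by rewrite /w /= mulrA.
  rewrite -(pairE (fun _ _ => true)
    (fun r1 r2 => potential x (survivors (rcons (rcons c r1) r2)))).
  apply: (potential_step (w := w) x0 xs) => //.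
  + by move=> y; rewrite mulr_ge0 ?row_weight_ge0.
  + have := pairE (fun _ _ => true) (fun _ _ => 1).
    under eq_bigr do rewrite mulr1.
    move=> ->; under eq_bigr => r1 _.
      under eq_bigr do rewrite mulr1.
      rewrite row_weight_sum mulr1; over.
    exact: row_weight_sum.
  + by move=> y; apply: leq_trans (survivors_rcons _ _) (survivors_rcons _ _).
  + exact: odd_survivors.
  + by rewrite -n_half survivors_leq.
  + move=> c0; apply: le_trans (drop c nz c0) _; rewrite ler_wpM2l //.
    have := pairE (fun r1 r2 => (survivors (rcons (rcons c r1) r2) < survivors c)%N)
      (fun _ _ => 1).
    under eq_bigr do rewrite mulr1.
    move=> ->; apply: ler_sum => r1 _; rewrite ler_wpM2l ?row_weight_ge0 //.
    by rewrite /row_prob; under [leRHS]eq_bigr do rewrite mulr1.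
- rewrite ler_wpM2l ?exprn_ge0 ?subr_ge0 //.
  by apply: (potential_le4 x0 xs); rewrite -n_half.
Qed.

(** Here [phi] is the indicator of survival itself, so no prefactor [4] appears. *)
Lemma survival_extinction2 (q : R) h : 0 <= q <= 1 ->
    (forall c, ~~ odd (size c) -> q <= extinction_prob2 md p c) ->
  survival h.*2 <= (1 - q) ^+ h.
Proof.
move=> /andP[q0 q1] ext; rewrite -[leRHS]mulr1.
apply: le_trans (@survival_decay2 (fun k => (0 < k)%N%:R) (1 - q) h _ _ _) _.
- by rewrite subr_ge0.
- by [].
- move=> c ec nz; case: (posnP (survivors c)) => [c0|_].
    rewrite mulr0 big1 // => r1 _; rewrite big1 ?mulr0 // => r2 _.
    suff -> : survivors (rcons (rcons c r1) r2) = 0%N by rewrite mulr0.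
    apply/eqP; rewrite -leqn0 -c0.
    exact: leq_trans (survivors_rcons _ _) (survivors_rcons _ _).
  rewrite mulr1 lerBrDr.
  apply: le_trans (lerD (lexx _) (ext c ec)) _.
  rewrite -big_split /= -[leRHS](row_weight_sum md n p (size c).+1).
  apply: ler_sum => r1 _; rewrite -mulrDr -[leRHS]mulr1.
  rewrite ler_wpM2l ?row_weight_ge0 //.
  rewrite -[leRHS](row_weight_sum md n p (size c).+2) /row_prob.
  rewrite [X in _ + X]big_mkcond -big_split /=; apply: ler_sum => r2 _.
  by case: (survivors _) => [|k] /=; rewrite ?mulr0 ?mulr1 ?add0r ?addr0.
- by rewrite ler_wpM2l ?exprn_ge0 ?subr_ge0 //; case: (0 < n)%N.
Qed.

End Decay.

(** * Numerical estimates *)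

Section Numerics.
Import numFieldNormedType.Exports.
Variable R : realType.
Implicit Types x y p : R.

Lemma expR_ge_taylor x N : 0 <= x ->
  \sum_(k < N) x ^+ k / k`!%:R <= expR x.
Proof.
move=> x0; rewrite -(big_mkord xpredT (fun k => x ^+ k / k`!%:R)).
rewrite /expR; apply: (@nondecreasing_cvgn_le _ (series (exp_coeff x))).
  apply: nondecreasing_series => k _ _.
  by rewrite /exp_coeff /= divr_ge0 ?exprn_ge0.
exact: is_cvg_series_exp_coeff.
Qed.

Lemma expR_ge_taylor4 x : 0 <= x ->
  1 + x + x ^+ 2 / 2 + x ^+ 3 / 6 + x ^+ 4 / 24 <= expR x.
Proof.
move=> /(@expR_ge_taylor _ 5); rewrite !big_ord_recr big_ord0 /=.
by rewrite !factS fact0 !muln1 /=; lra.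
Qed.

Lemma expR_ge_taylor2 x : 0 <= x -> 1 + x + x ^+ 2 / 2 <= expR x.
Proof.
move=> x0; have := expR_ge_taylor4 x0.
by have := exprn_ge0 3 x0; have := exprn_ge0 4 x0; lra.
Qed.

Lemma expR1_ge : 8 / 3 <= expR 1 :> R.
Proof. by have := expR_ge_taylor4 (@ler01 R); rewrite !expr1n; lra. Qed.

(** The tangent at [1] gives [exp x >= e x], and [e >= 8/3]. *)
Lemma expR_ge_linear x : 8 / 3 * x <= expR x.
Proof.
have [x0|x0] := lerP 0 x; last first.
  by have := expR_gt0 x; lra.
have := expR_ge1Dx (x - 1); rewrite addrCA subrr addr0 => H.
have -> : expR x = expR 1 * expR (x - 1) by rewrite -expRD addrC subrK.
by have := expR1_ge; nra.
Qed.

Lemma expRN_le x (a : R) : 0 < a -> a^-1 <= expR x -> expR (- x) <= a.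
Proof. by move=> a0 H; rewrite expRN invf_ple ?posrE ?expR_gt0. Qed.

(* With z = 1/y and u = (z - 1/z)/2 one has
   8 z^2 (1 + u + u^2/2 - z) = (z - 1)^4. *)
Lemma expR_inv_le y : 0 < y -> y <= 1 -> expR (- ((y^-1 - y) / 2)) <= y.
Proof.
move=> y0 y1; apply: expRN_le => //.
have z1 : 1 <= y^-1 by rewrite invf_ge1.
apply: le_trans (expR_ge_taylor2 _); last first.
  by rewrite divr_ge0 // subr_ge0 (le_trans y1).
have -> : 1 + (y^-1 - y) / 2 + ((y^-1 - y) / 2) ^+ 2 / 2 =
  y^-1 + (y * (y^-1 - 1) ^+ 2) ^+ 2 / 8 by field; rewrite gt_eqF.
by rewrite lerDl divr_ge0 ?sqr_ge0.
Qed.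

Lemma one_sub_ge_expR p : 0 <= p -> p <= 1 / 2 ->
  expR (- (p * (2 - p) / (2 * (1 - p)))) <= 1 - p.
Proof.
move=> p0 p1; have y0 : 0 < 1 - p by lra.
have := expR_inv_le y0; rewrite gerBl => /(_ p0).
suff -> : ((1 - p)^-1 - (1 - p)) / 2 = p * (2 - p) / (2 * (1 - p)) by [].
by field; rewrite gt_eqF.
Qed.

Lemma one_sub_ge_expR_sqr p : 0 <= p -> p <= 1 / 2 ->
  expR (- (p + p ^+ 2)) <= 1 - p.
Proof.
move=> p0 p1; apply: le_trans (one_sub_ge_expR p0 p1).
rewrite ler_expR lerN2 ler_pdivrMr; last by lra.
by nra.
Qed.

(** Compared with [exp (- p n)], the power loses at most a factor
    [exp (- p^2 n) >= exp (- 2/3) >= 10/21]. *)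
Lemma sparse_expR_le (n : nat) p : 0 <= p -> p <= 1 / 2 -> p ^+ 2 * n%:R <= 2 / 3 ->
  expR (- (p * n%:R)) <= 21 / 10 * (1 - p) ^+ (n - 2).
Proof.
move=> p0 p1 pn; have y0 : 0 <= 1 - p by lra.
apply: le_trans (_ : 21 / 10 * (1 - p) ^+ n <= _); last first.
  by rewrite ler_wpM2l // ler_wiXn2l ?leq_subr //; lra.
have H : expR (- (p + p ^+ 2)) ^+ n <= (1 - p) ^+ n.
  by rewrite lerXn2r ?nnegrE ?expR_ge0 // one_sub_ge_expR_sqr.
apply: le_trans (_ : 21 / 10 * expR (- (p + p ^+ 2)) ^+ n <= _); last first.
  by rewrite ler_wpM2l.
rewrite -expRM_natl.
have -> : n%:R * - (p + p ^+ 2) = - (p * n%:R) + - (p ^+ 2 * n%:R) by ring.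
rewrite expRD mulrCA ler_peMr ?expR_ge0 //.
have : expR (- (2 / 3 : R)) <= expR (- (p ^+ 2 * n%:R)) by rewrite ler_expR lerN2.
suff : 10 / 21 <= expR (- (2 / 3 : R)) by lra.
(* The bound used is [exp (- 2/3) >= (11/12)^8 >= 10/21]. *)
have -> : - (2 / 3) = - (1 / 12) * 8%:R :> R by field.
rewrite expRM_natr; have := expR_ge1Dx (- (1 / 12) : R).
set e := expR _ => He.
have : (11 / 12) ^+ 8 <= e ^+ 8 by rewrite lerXn2r ?nnegrE //; lra.
by apply: le_trans; lra.
Qed.

Lemma moderate_expR_le (n : nat) p : 0 < p -> p <= 1 / 2 -> ~~ odd n ->
  2 / 3 <= p ^+ 2 * n%:R ->
  n%:R * expR (- (p * n%:R)) <= 6 * (1 - p) ^+ (n./2).+1.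
Proof.
move=> p0 p1 n_even pn; have y0 : 0 < 1 - p by lra.
(* What is left of the rate [p] per column after paying for [n/2] factors [1 - p]; it has to absorb
   the factor [n]. *)
pose g := p * (2 - 3 * p) / (4 * (1 - p)).
have H : expR (- (p * n%:R)) <= expR (- (g * n%:R)) * (1 - p) ^+ n./2.
  have : expR (- (p * (2 - p) / (2 * (1 - p)))) ^+ n./2 <= (1 - p) ^+ n./2.
    by rewrite lerXn2r ?nnegrE ?expR_ge0 ?(ltW y0) // one_sub_ge_expR // ltW.
  move=> /(ler_wpM2l (expR_ge0 (- (g * n%:R)))); apply: le_trans.
  rewrite -expRM_natl -expRD ler_expR le_eqVlt; apply/orP; left; apply/eqP.
  have -> : n%:R = 2 * (n./2)%:R :> R.
    by rewrite -natrM mul2n -{1}(odd_double_half n) (negbTE n_even).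
  by rewrite /g; field; rewrite gt_eqF.
have K : n%:R * expR (- (g * n%:R)) <= 6 * (1 - p).
  have [p5|p5] := lerP (1 / 5) p.
    have g0 : 1 / 16 <= g * (1 - p).
      have -> : g * (1 - p) = p * (2 - 3 * p) / 4.
        by rewrite /g; field; rewrite gt_eqF.
      by nra.
    have := expR_ge_linear (g * n%:R); have := expR_gt0 (g * n%:R).
    rewrite expRN => e0 He; rewrite ler_pdivrMr //.
    have n0 : 0 <= n%:R :> R by [].
    have y1 := ltW y0.
    have : 6 * (1 - p) * (8 / 3 * (g * n%:R)) <= 6 * (1 - p) * expR (g * n%:R).
      by rewrite ler_wpM2l // mulr_ge0.
    apply: le_trans.
    have -> : 6 * (1 - p) * (8 / 3 * (g * n%:R)) = 16 * (g * (1 - p)) * n%:R by field.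
    by rewrite ler_peMl //; lra.
  have g7 : 7 / 16 * p <= g.
    rewrite /g ler_pdivlMr; last by lra.
    by nra.
  pose w := 7 / 32 * (p * n%:R).
  have w0 : 0 <= w by rewrite /w !mulr_ge0 // ltW.
  have He : expR (- (g * n%:R)) <= expR (- w) ^+ 2.
    rewrite -expRM_natl ler_expR mulrN lerN2 /w.
    by have := ler_wpM2r (ler0n R n) g7; lra.
  have Hw := expR_ge_linear w.
  (* For small [p] the hypothesis bounds [n] by a square of [p n], which the square of
     [exp w >= 8/3 w] absorbs. *)
  have n2 : n%:R <= 3 / 2 * (p * n%:R) ^+ 2.
    have -> : 3 / 2 * (p * n%:R) ^+ 2 = 3 / 2 * (p ^+ 2 * n%:R) * n%:R by ring.
    by rewrite ler_peMl //; lra.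
  apply: le_trans (ler_wpM2l (ler0n R n) He) _.
  rewrite expRN exprVn ler_pdivrMr ?exprn_gt0 ?expR_gt0 //.
  have Hw2 : (8 / 3 * w) ^+ 2 <= expR w ^+ 2.
    by rewrite lerXn2r ?nnegrE ?expR_ge0 // mulr_ge0.
  apply: le_trans n2 _.
  apply: le_trans (_ : 6 * (4 / 5) * (8 / 3 * w) ^+ 2 <= _).
    by rewrite /w; have := sqr_ge0 (p * n%:R); lra.
  by apply: ler_pM => //; [exact: sqr_ge0|lra].
rewrite exprS mulrA; apply: le_trans (ler_wpM2l (ler0n R n) H) _.
by rewrite mulrA ler_wpM2r // exprn_ge0 // ltW.
Qed.

Lemma dense_expR_le (n : nat) p : 1 / 2 <= p -> p <= 3 / 4 -> ~~ odd n -> (0 < n)%N ->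
  n%:R * expR (- (p * n%:R)) <= 6 * (1 - p) ^+ (n./2).-1.
Proof.
move=> p1 p2 n_even n0; have y0 : 0 < 1 - p by lra.
have log2 : 2 <= expR (7 / 10 : R).
  by apply: le_trans (expR_ge_taylor4 _); lra.
have quarter : expR (- (7 / 5)) <= 1 / 4 :> R.
  apply: expRN_le; first by lra.
  have -> : 7 / 5 = 7 / 10 * 2%:R :> R by field.
  by rewrite expRM_natr; have := expR_gt0 (7 / 10 : R); nra.
(* [1 - p] is split as [1/4] times [4 (1 - p)]. The surplus [1/15] per pair of columns adds up to
   [exp (n / 30)], which absorbs the factor [n]. *)
have H : expR (- (2 * p) + 1 / 15) <= 1 - p.
  apply: le_trans (_ : expR (- (7 / 5) - ((4 * (1 - p))^-1 - 1)) <= _).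
    rewrite ler_expR -(ler_pM2r y0).
    have -> : (- (7 / 5) - ((4 * (1 - p))^-1 - 1)) * (1 - p) =
      - (2 / 5) * (1 - p) - 1 / 4 by field; rewrite gt_eqF.
    by nra.
  have q0 : 0 < 4 * (1 - p) by lra.
  have q1 : expR (- ((4 * (1 - p))^-1 - 1)) <= 4 * (1 - p).
    apply: expRN_le => //.
    by apply: le_trans (expR_ge1Dx _); lra.
  rewrite expRD [leRHS](_ : _ = 1 / 4 * (4 * (1 - p))); last by field.
  by apply: ler_pM => //; exact: expR_ge0.
rewrite -(ler_pM2r y0) -[leRHS]mulrA -exprSr prednK; last first.
  by have := odd_double_half n; rewrite (negbTE n_even); lia.
have : expR (- (2 * p) + 1 / 15) ^+ n./2 <= (1 - p) ^+ n./2.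
  by rewrite lerXn2r ?nnegrE ?expR_ge0 // ltW.
have nE : n%:R = 2 * (n./2)%:R :> R.
  by rewrite -natrM mul2n -{1}(odd_double_half n) (negbTE n_even).
rewrite -expRM_natl.
have -> : (n./2)%:R * (- (2 * p) + 1 / 15) = - (p * n%:R) + n%:R / 30 :> R.
  by rewrite nE; field.
rewrite expRD => K.
apply: le_trans (_ : 6 * (expR (- (p * n%:R)) * expR (n%:R / 30)) <= _); last first.
  by rewrite ler_wpM2l.
have := expR_ge_linear (n%:R / 30); set e := expR (n%:R / 30) => He.
have := expR_ge0 (- (p * n%:R)); set f := expR _ => f0.
have -> : n%:R * f * (1 - p) = f * (n%:R * (1 - p)) by ring.
rewrite [leRHS]mulrCA ler_wpM2l //.
by have := ler0n R n; nra.
Qed.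

(** Raised to the power [n/2], this compares the probability of a wall with [exp (- p n)]. *)
Lemma wall_base_mat p : 1 / 2 <= p -> p <= 1 ->
  expR (- (2 * p)) <= 2 * p ^+ 2 - p ^+ 4.
Proof.
move=> p1 p2; apply: le_trans (_ : expR (- 1) <= _).
  by rewrite ler_expR lerN2; lra.
apply: le_trans (_ : 3 / 8 <= _).
  by apply: expRN_le; [lra|apply: le_trans expR1_ge; lra].
have : 1 / 4 <= p ^+ 2 <= 1 by nra.
have -> : p ^+ 4 = (p ^+ 2) ^+ 2 by rewrite -exprM.
by move=> /andP[]; nra.
Qed.

Lemma wall_base_mir p : 3 / 4 <= p -> p <= 1 ->
  expR (- (2 * p)) <= 2 * (p / 2) ^+ 2 - (p / 2) ^+ 4.
Proof.
move=> p1 p2; apply: le_trans (_ : expR (- (3 / 2)) <= _).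
  by rewrite ler_expR lerN2; lra.
apply: le_trans (_ : 1 / 4 <= _).
  apply: expRN_le; first lra.
  by apply: le_trans (expR_ge_taylor4 _); lra.
have : 9 / 64 <= (p / 2) ^+ 2 <= 1 / 4 by nra.
have -> : (p / 2) ^+ 4 = ((p / 2) ^+ 2) ^+ 2 by rewrite -exprM.
by move=> /andP[]; nra.
Qed.

(** The induction carries the remainder [1 / (8 N + 2)], for which [N = 1] is an equality. The full
    series is [ln 2 / 2], just below [7/20]. *)
Lemma sum_pairs_le N :
  \sum_(j < N) 1 / (4 * j.+1%:R * (2 * j.+1%:R - 1)) <= 7 / 20 :> R.
Proof.
case: N => [|N]; first by rewrite big_ord0; lra.
suff : \sum_(j < N.+1) 1 / (4 * j.+1%:R * (2 * j.+1%:R - 1)) <=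
    7 / 20 - 1 / (8 * N.+1%:R + 2) :> R.
  have : 0 <= 1 / (8 * N.+1%:R + 2) :> R by rewrite divr_ge0 // addr_ge0.
  by lra.
elim: N => [|N IH].
  by rewrite big_ord1 /= le_eqVlt; apply/orP; left; apply/eqP; field.
rewrite big_ord_recr /=; apply: le_trans (lerD IH (lexx _)) _.
rewrite -[N.+2%:R]natr1; set x := N.+1%:R.
have x1 : 1 <= x :> R by rewrite ler1n.
rewrite -subr_ge0.
have -> : 7 / 20 - 1 / (8 * (x + 1) + 2) -
    (7 / 20 - 1 / (8 * x + 2) + 1 / (4 * (x + 1) * (2 * (x + 1) - 1))) =
    3 / (2 * (4 * x + 1) * (4 * x + 5) * (x + 1) * (2 * x + 1) * 2) :> R.
  by field; rewrite !gt_eqF //; lra.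
by rewrite divr_ge0 // !mulr_ge0 //; lra.
Qed.

Lemma sin_le_id x : 0 <= x -> sin x <= x.
Proof.
move=> x0.
have [|c _] := @MVT_segment R sin cos 0 x x0 (fun y _ => is_derive_sin y).
  by apply/continuous_subspaceT => ?; exact: continuous_sin.
rewrite sin0 !subr0 => ->.
by rewrite ler_piMl // cos_le1.
Qed.

(** [sin (pi / 4)] has square [1/2] and is at most [pi / 4]. *)
Lemma pi_sqr_ge8 : 8 <= pi ^+ 2 :> R.
Proof.
have : cos (pi / 4 *+ 2) = 0 :> R.
  by rewrite (_ : pi / 4 *+ 2 = pi / 2) ?cos_pihalf // mulr2n; field.
rewrite cos_mulr2n => C; have := cos2Dsin2 (pi / 4 : R).
have q0 : 0 <= pi / 4 :> R by rewrite divr_ge0 ?pi_ge0.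
have := sin_le_id q0.
have : 0 <= sin (pi / 4 : R).
  by apply: sin_ge0_pi; rewrite q0 /=; have := pi_ge0 R; lra.
rewrite mulr2n in C.
by nra.
Qed.

Lemma pi_ge : 14 / 5 <= pi :> R.
Proof. by have := pi_sqr_ge8; have := pi_ge0 R; nra. Qed.

(** Slightly more than [2] is needed, to make room for the factor [exp (2 theta)] in the
    prefactor. *)
Lemma A_const_ge md : 21 / 10 <= A_const R md.
Proof.
have pi1 := pi_ge; have pi0 : 0 < pi :> R by exact: pi_gt0.
have := expR_ge_taylor4 (ltW pi0).
have eN0 := expR_gt0 (- pi : R).
have eN1 : expR (- pi) <= 1 :> R by rewrite expR_le1 oppr_le0 ltW.
case: md => /= E; rewrite /cosh /sinh.
  by have := exprn_ge0 3 (ltW pi0); have := exprn_ge0 4 (ltW pi0); nra.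
rewrite ler_pdivlMr // ler_pdivlMr //.
suff : 42 / 10 <= 1 + pi / 2 + pi ^+ 2 / 6 + pi ^+ 3 / 24 :> R.
  move=> /(ler_wpM2r (ltW pi0)) H.
  have -> : 21 / 10 * pi * 2 = 42 / 10 * pi :> R by ring.
  apply: le_trans H _; rewrite lerBrDr.
  apply: le_trans E; lra.
have : (14 / 5) ^+ 2 <= pi ^+ 2 :> R by rewrite lerXn2r ?nnegrE // ltW.
have : (14 / 5) ^+ 3 <= pi ^+ 3 :> R by rewrite lerXn2r ?nnegrE // ltW.
lra.
Qed.

End Numerics.

(** * Tail of the height *)

Section Tail.
Variables (R : realType) (md : model) (n : nat) (p : R).
Hypotheses (p_gt0 : 0 < p) (p_le1 : p <= 1).
Hypotheses (n_even : ~~ odd n) (n_gt0 : (0 < n)%N).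

Local Notation survival := (survival md n p).

Definition rate : R := p ^+ 2 * expR (- (p * n%:R)) / 8.

Let p_ge0 : 0 <= p. Proof. exact: ltW. Qed.
Let p2_ge0 : 0 <= p ^+ 2. Proof. exact: sqr_ge0. Qed.

Let n_half : n%:R = 2 * (n./2)%:R :> R.
Proof. by rewrite -natrM mul2n -{1}(odd_double_half n) (negbTE n_even). Qed.

Let nR_gt0 : 0 < n%:R :> R. Proof. by rewrite ltr0n. Qed.

Lemma rate_ge0 : 0 <= rate.
Proof. by rewrite /rate divr_ge0 ?mulr_ge0 ?expR_ge0. Qed.

(** As [n >= 2], the rate is at most [(p exp (- p))^2 / 8]. *)
Lemma rate_le : rate <= 9 / 512.
Proof.
have e0 := expR_ge0 (- p); have pe : p * expR (- p) <= 3 / 8.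
  rewrite expRN ler_pdivrMr ?expR_gt0 //.
  by have := expR_ge_linear p; lra.
have : expR (- (p * n%:R)) <= expR (- p) ^+ 2.
  rewrite -expRM_natl ler_expR mulrN lerN2 mulrC ler_wpM2l //.
  by rewrite ler_nat; case: n n_even n_gt0 => [|[|]].
have : (p * expR (- p)) ^+ 2 <= (3 / 8) ^+ 2.
  by rewrite lerXn2r ?nnegrE ?mulr_ge0.
rewrite exprMn /rate => H1 /(ler_wpM2l p2_ge0) H2; lra.
Qed.

Lemma exprn_le_expR (t : R) m : 0 <= t <= 1 -> (1 - t) ^+ m <= expR (- (t * m%:R)).
Proof.
move=> /andP[t0 t1]; rewrite -mulNr expRM_natr lerXn2r ?nnegrE ?expR_ge0 ?subr_ge0 //.
exact: expR_ge1Dx.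
Qed.

Lemma survival_tail1 m : (forall h, survival h <= 4 * (1 - rate) ^+ h) ->
  survival m <= 4 * expR rate * expR (- (rate * m%:R)).
Proof.
move=> H; apply: le_trans (H m) _; rewrite -mulrA ler_wpM2l //.
have r1 : 0 <= rate <= 1 by rewrite rate_ge0 /=; have := rate_le; lra.
apply: le_trans (exprn_le_expR m r1) _.
by rewrite ler_peMl ?expR_ge0 // -expR0 ler_expR rate_ge0.
Qed.

(** An odd [m] is rounded down to an even number, which costs the factor [expR rate]. *)
Lemma survival_tail2 m : (forall h, survival h.*2 <= 4 * (1 - 2 * rate) ^+ h) ->
  survival m <= 4 * expR rate * expR (- (rate * m%:R)).
Proof.
move=> H; apply: (@le_trans _ _ (survival (m./2).*2)).
  by apply: survival_le => //; rewrite -{2}(odd_double_half m) leq_addl.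
apply: le_trans (H _) _; rewrite -mulrA ler_wpM2l //.
have r0 := rate_ge0.
have r1 : 0 <= 2 * rate <= 1 by have := rate_le; lra.
apply: le_trans (exprn_le_expR _ r1) _.
rewrite -expRD ler_expR -{2}(odd_double_half m) natrD -mul2n natrM.
by case: (odd m); rewrite ?mulr1n ?mulr0n; lra.
Qed.

Lemma survival_sparse m : p <= 1 / 2 -> p ^+ 2 * n%:R <= 2 / 3 ->
  survival m <= 4 * expR rate * expR (- (rate * m%:R)).
Proof.
move=> p1 pn; apply: survival_tail1 => h.
(* The weights are inverse to the number of pairs of NS paths; [21/10] comes from [sparse_expR_le],
   and the sum is at most [21/10 * 7/20 <= 3/4]. *)
pose x j : R := 21 / 10 * (1 / (4 * j%:R * (2 * j%:R - 1))).
apply: (survival_drop p_ge0 p_le1 n_even (x := x)) => //.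
- case=> [|j]; rewrite /x; first by rewrite mulr0 mul0r invr0 mulr0 mulr0.
  have j1 : 1 <= j.+1%:R :> R by rewrite ler1n.
  by rewrite !mulr_ge0 // ?invr_ge0 ?mulr_ge0 //; lra.
- by rewrite -mulr_sumr; have := sum_pairs_le R n./2; lra.
- by rewrite rate_ge0; have := rate_le; lra.
move=> c nz c0; set k := (survivors c)./2.
have ck : survivors c = k.*2.
  by rewrite -{1}(odd_double_half (survivors c)) (negbTE (odd_survivors c n_even)).
have k0 : (0 < k)%N by move: c0; rewrite ck double_gt0.
have x0 : 0 <= x k.
  have k1 : 1 <= k%:R :> R by rewrite ler1n.
  by rewrite !mulr_ge0 // ?invr_ge0 ?mulr_ge0 //; lra.
apply: le_trans (ler_wpM2l x0 (drop_prob_pairs p_ge0 p_le1 n_even nz ck)).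
have k1 : 1 <= k%:R :> R by rewrite ler1n.
have -> : (k * (k.*2).-1)%:R = k%:R * (2 * k%:R - 1) :> R.
  by rewrite natrM -subn1 natrB ?double_gt0 // -mul2n natrM.
have -> : x k * (k%:R * (2 * k%:R - 1) / 2 * p ^+ 2 * (1 - p) ^+ (n - 2)) =
    p ^+ 2 * (21 / 10 * (1 - p) ^+ (n - 2)) / 8.
  by rewrite /x; field; rewrite !gt_eqF //; lra.
rewrite /rate ler_wpM2r // ler_wpM2l //.
exact: sparse_expR_le.
Qed.

(** The bounds from arcs do not depend on the number of NS paths, so the [n/2] weights share [3/4]
    equally. *)
Let x_const : R := 3 / (2 * n%:R).

Let x_const_ge0 : 0 <= x_const.
Proof. by rewrite divr_ge0 // mulr_ge0. Qed.

Let x_const_sum : \sum_(j < n./2) x_const <= 3 / 4.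
Proof.
rewrite sumr_const card_ord -mulr_natl /x_const n_half.
rewrite le_eqVlt; apply/orP; left; apply/eqP; field.
by move: nR_gt0; rewrite n_half pmulr_rgt0 // => /gt_eqF ->.
Qed.

Lemma survival_arcs_mir m : md = Mir ->
    n%:R * expR (- (p * n%:R)) <= 6 * (1 - p) ^+ (n./2).-1 ->
  survival m <= 4 * expR rate * expR (- (rate * m%:R)).
Proof.
move=> mdE reg; apply: survival_tail1 => h.
apply: (survival_drop p_ge0 p_le1 n_even (x := fun=> x_const)) => //.
  by rewrite rate_ge0; have := rate_le; lra.
move=> c nz c0.
apply: le_trans (ler_wpM2l x_const_ge0 (drop_prob_arcs p_ge0 p_le1 n_even mdE c0)).
rewrite /rate /x_const; set y := (1 - p) ^+ _ in reg *.
have -> : 3 / (2 * n%:R) * (p ^+ 2 / 2 * y) = p ^+ 2 / 8 * (6 * y / n%:R).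
  by field; rewrite gt_eqF.
rewrite mulrAC ler_wpM2l ?divr_ge0 // ler_pdivlMr // mulrC.
exact: reg.
Qed.

Lemma survival_arcs_mat m : md = Mat ->
    n%:R * expR (- (p * n%:R)) <= 6 * (1 - p) ^+ (n./2).+1 ->
  survival m <= 4 * expR rate * expR (- (rate * m%:R)).
Proof.
move=> mdE reg; apply: survival_tail2 => h.
apply: (survival_drop2 p_ge0 p_le1 n_even (x := fun=> x_const)) => //.
  by have := rate_ge0; have := rate_le; lra.
move=> c nz c0.
apply: le_trans
  (ler_wpM2l x_const_ge0 (drop_prob2_arcs p_ge0 p_le1 n_even mdE nz c0)).
rewrite /rate /x_const; set y := (1 - p) ^+ _ in reg *.
have -> : 3 / (2 * n%:R) * (p ^+ 2 * y) = p ^+ 2 / 4 * (6 * y / n%:R).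
  by field; rewrite gt_eqF.
have -> : 2 * (p ^+ 2 * expR (- (p * n%:R)) / 8) = p ^+ 2 / 4 * expR (- (p * n%:R)).
  by field.
by rewrite ler_wpM2l ?divr_ge0 // ler_pdivlMr // mulrC.
Qed.

Lemma survival_wall_bound m :
    expR (- (2 * p)) <= 2 * mirror_prob md p ^+ 2 - mirror_prob md p ^+ 4 ->
  survival m <= 4 * expR rate * expR (- (rate * m%:R)).
Proof.
move=> reg; apply: survival_tail2 => h.
set b := _ - _ in reg.
have b1 : b <= 1.
  have -> : b = 1 - (mirror_prob md p ^+ 2 - 1) ^+ 2 by rewrite /b; ring.
  by rewrite gerBl sqr_ge0.
have b0 : 0 <= b by apply: le_trans (expR_ge0 _) reg.
have bE : expR (- (p * n%:R)) <= b ^+ n./2.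
  have -> : - (p * n%:R) = - (2 * p) * (n./2)%:R by rewrite n_half; ring.
  by rewrite expRM_natr lerXn2r ?nnegrE ?expR_ge0.
apply: le_trans (survival_extinction2 (q := b ^+ n./2) p_ge0 p_le1 h _ _) _.
- by rewrite exprn_ge0 // exprn_ile1.
- by move=> c ec; exact: extinction_prob2_wall.
have e0 := expR_ge0 (- (p * n%:R)).
have q1 : b ^+ n./2 <= 1 by rewrite exprn_ile1.
have rb : 2 * rate <= b ^+ n./2.
  apply: le_trans bE; rewrite /rate.
  have : p ^+ 2 <= 1 by rewrite exprn_ile1.
  by nra.
apply: (@le_trans _ _ ((1 - 2 * rate) ^+ h)).
  by rewrite lerXn2r ?nnegrE ?subr_ge0 ?lerD2l ?lerN2 //; apply: le_trans rb q1.
by rewrite ler_peMl ?exprn_ge0 ?subr_ge0 //; [apply: le_trans rb q1|lra].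
Qed.

Lemma survival_tail m :
  survival m <= 4 * expR rate * expR (- (rate * m%:R)).
Proof.
have [p1|p1] := lerP p (1 / 2).
  have [pn|/ltW pn] := lerP (p ^+ 2 * n%:R) (2 / 3); first exact: survival_sparse.
  (* The exponent [n/2 + 1] of the Manhattan case is the harder one, so this estimate serves both
     models. *)
  have reg := moderate_expR_le p_gt0 p1 n_even pn.
  have [mdE|mdE] : md = Mir \/ md = Mat by case: (md); [left|right].
    apply: survival_arcs_mir => //; apply: le_trans reg _.
    rewrite ler_wpM2l // ler_wiXn2l ?subr_ge0 ?gerBl //.
    exact: leq_trans (leq_pred _) (leqnSn _).
  exact: survival_arcs_mat.
have [mdE|mdE] : md = Mir \/ md = Mat by case: (md); [left|right].
  have [p2|/ltW p2] := lerP p (3 / 4).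
    apply: survival_arcs_mir => //; apply: dense_expR_le => //; exact: ltW.
  by apply: survival_wall_bound; rewrite /mirror_prob mdE; exact: wall_base_mir.
by apply: survival_wall_bound; rewrite /mirror_prob mdE wall_base_mat // ltW.
Qed.

End Tail.

(** * From words to the probability space *)

Local Open Scope classical_set_scope.

Section Probability.
Variables (R : realType) (md : model) (n : nat) (p : R).
Variables (d : measure_display) (T : measurableType d) (P : probability T R).
Variable X : vertex n -> T -> mirror.
Hypothesis hX : random_mirrors md p P X.

Local Notation row := {ffun 'I_n -> option orientation}.

Definition rows h (w : T) : seq row :=
  mkseq (fun t => [ffun i => X (t.+1%:Z, i) w]) h.

Lemma size_rows h w : size (rows h w) = h.
Proof. exact: size_mkseq. Qed.

Lemma strip_cfg_rows h w v : 1 <= v.1 <= h%:Z -> strip_cfg (rows h w) v = X v w.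
Proof.
case: v => -[[|t]|t] i //= ht; rewrite /strip_cfg /= nth_mkseq ?ffunE //; lia.
Qed.

Lemma survivors_rows h w :
  survivors (rows h w) = #|crossing false (fun v => X v w) h|.
Proof.
rewrite /survivors size_rows; congr #|pred_of_set _|.
by apply: eq_crossing => v; exact: strip_cfg_rows.
Qed.

Let strip h : seq (vertex n) := [seq (t.+1%:Z, i) | t <- iota 0 h, i <- enum 'I_n].

Let strip_uniq h : uniq (strip h).
Proof.
apply: allpairs_uniq; [exact: iota_uniq|exact: enum_uniq|].
by move=> [t i] [t' i'] _ _ /= [-> ->].
Qed.

(** This puts the event into the form required by [independent_mirrors]. *)
Let rows_eqE h (c : seq row) : size c = h ->
  [set w | rows h w = c] =
  [set w | forall v, v \in strip h -> [set strip_cfg c v] (X v w)].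
Proof.
move=> ch; apply/seteqP; split => w /=.
  move=> <- v /allpairsP[[t i] /= [ht _ ->]]; rewrite mem_iota /= in ht.
  by rewrite strip_cfg_rows //=; lia.
move=> H; apply: (@eq_from_nth _ [ffun=> None]); rewrite size_rows //.
move=> t ht; rewrite nth_mkseq //; apply/ffunP => i; rewrite ffunE.
by rewrite H //; apply/allpairsP; exists (t, i); rewrite mem_iota mem_enum.
Qed.

Lemma measurable_rows_eq h c : measurable [set w | rows h w = c].
Proof.
have [ch|ch] := eqVneq (size c) h; last first.
  rewrite (_ : [set _ | _] = set0) //; apply/seteqP; split=> // w /= E.
  by move: ch; rewrite -E size_rows eqxx.
rewrite rows_eqE //.
have -> : [set w | forall v, v \in strip h -> [set strip_cfg c v] (X v w)] =
    \big[setI/setT]_(v <- strip h) X v @^-1` [set strip_cfg c v].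
  elim: (strip h) => [|v s IH].
    by rewrite big_nil; apply/seteqP; split=> // w _ v.
  rewrite big_cons -IH; apply/seteqP; split=> w /=.
    by move=> H; split=> [|v' sv']; apply: H; rewrite inE ?eqxx ?sv' ?orbT.
  by move=> [H1 H2] v'; rewrite inE => /orP[/eqP ->|/H2].
by case: hX => mX _ _; apply: bigsetI_measurable => v _; exact: mX.
Qed.

Lemma prob_rows_eq h c : size c = h ->
  P [set w | rows h w = c] = (word_weight md p c)%:E.
Proof.
move=> ch; rewrite rows_eqE //; case: hX => mX lX iX.
rewrite (iX (strip h) (fun v => [set strip_cfg c v])) //.
under eq_bigr do rewrite lX.
rewrite prodEFin; congr EFin; rewrite big_allpairs_dep /word_weight ch.
rewrite -{1}(subn0 h) -/(index_iota 0 h) big_mkord.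
by apply: eq_bigr => t _; rewrite big_enum.
Qed.

(** An event about the first [h] streets is a finite disjoint union of events [rows h w = c]. *)
Lemma prob_rows h (G : pred (seq row)) :
  measurable [set w | G (rows h w)] /\
  P [set w | G (rows h w)] = (expect md p h (fun c => (G c)%:R))%:E.
Proof.
have sub (s : seq (seq row)) : uniq s -> {subset s <= words n h} ->
    measurable [set w | rows h w \in s] /\
    P [set w | rows h w \in s] = (\sum_(c <- s) word_weight md p c)%:E.
  elim: s => [|c s IH] /=.
    rewrite big_nil (_ : [set _ | _] = set0) ?measure0 //.
    by apply/seteqP; split.
  move=> /andP[cs us] sw; have [|ms Ps] := IH us.
    by move=> c' sc'; apply: sw; rewrite inE sc' orbT.
  have -> : [set w | rows h w \in c :: s] =
      [set w | rows h w = c] `|` [set w | rows h w \in s].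
    apply/seteqP; split=> w /=; rewrite inE.
      by case/orP => [/eqP|]; [left|right].
    by case=> [->|->]; rewrite ?eqxx ?orbT.
  have mc := measurable_rows_eq h c; split; first exact: measurableU.
  have Pc : P [set w | rows h w = c] = (word_weight md p c)%:E.
    by apply: prob_rows_eq; apply: size_words; apply: sw; rewrite inE eqxx.
  rewrite big_cons EFinD -Pc -Ps; apply: measureU => //.
  by apply/seteqP; split=> // w /= [-> sc]; rewrite sc in cs.
have [||mG PG] := sub [seq c <- words n h | G c].
- by rewrite filter_uniq // words_uniq.
- by move=> c; rewrite mem_filter => /andP[].
have E : [set w | rows h w \in [seq c <- words n h | G c]] = [set w | G (rows h w)].
  by apply/seteqP; split=> w /=; rewrite mem_filter mem_words ?size_rows // andbT.
rewrite E in mG PG; split=> //; rewrite PG; congr EFin.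
rewrite big_filter big_mkcond /expect; apply: eq_bigr => c _.
by case: (G c); rewrite ?mulr1 ?mulr0.
Qed.

End Probability.

(** * The height in terms of the number of NS paths *)

Section Height.
Variables (R : realType) (n : nat) (n_even : ~~ odd n) (n_gt0 : (0 < n)%N).
Variable cfg : configuration n.

Lemma no_crossing_num_bars i :
  num_bars (diagram cfg i) = n./2 <-> #|crossing false cfg i| = 0%N.
Proof.
have := num_bars_crossing cfg i; have := odd_double_half n.
by rewrite (negbTE n_even); lia.
Qed.

Lemma crossing_le i j : (i <= j)%N ->
  #|crossing false cfg i| = 0%N -> #|crossing false cfg j| = 0%N.
Proof.
move=> ij i0; apply/eqP; rewrite -leqn0 -i0.
by apply: subset_leq_card; exact: crossing_subset_leq.
Qed.

Lemma crossing0 : #|crossing false cfg 0| = n.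
Proof.
rewrite -[RHS](survivors_nil n) /survivors /=; congr #|pred_of_set _|.
by apply: eq_crossing => v; lia.
Qed.

Lemma V_half_le m : #|crossing false cfg m| = 0%N -> 
  (V_half R cfg <= (m%:R)%:E)%E.
Proof.
move=> m0; apply: ereal_inf_lbound; exists m => //=; split.
  (* The required [1 <= m] holds because the empty strip has [n > 0] NS paths. *)
  by case: m m0 => //; rewrite crossing0 => n0; move: n_gt0; rewrite n0.
exact/no_crossing_num_bars.
Qed.

Lemma V_half_ge m : (0 < #|crossing false cfg m|)%N ->
  ((m.+1%:R)%:E <= V_half R cfg)%E.
Proof.
move=> m0; apply: le_ereal_inf_tmp => _ [i /= [_ /no_crossing_num_bars i0] <-].
rewrite lee_fin ler_nat ltnNge; apply/negP => im.
by move: m0; rewrite (crossing_le im i0).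
Qed.

(** The height is a natural number or infinite, so reaching [x] means exceeding [m]. *)
Lemma V_half_geE m (x : R) : m%:R < x -> x <= m.+1%:R ->
  (x%:E <= V_half R cfg)%E = (0 < #|crossing false cfg m|)%N.
Proof.
move=> mx xm; case: posnP => [/V_half_le le_m|/V_half_ge ge_m].
  by apply/negbTE; rewrite -ltNge; apply: le_lt_trans le_m _; rewrite lte_fin.
by apply: le_trans ge_m; rewrite lee_fin.
Qed.

Lemma V_half_leE m (x : R) : m%:R <= x -> x < m.+1%:R ->
  (V_half R cfg <= x%:E)%E = (#|crossing false cfg m| == 0%N).
Proof.
move=> mx xm; case: posnP => [/V_half_le le_m|/V_half_ge ge_m].
  by apply: le_trans le_m _; rewrite lee_fin.
by apply/negbTE; rewrite -ltNge; apply: lt_le_trans ge_m; rewrite lte_fin.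
Qed.

End Height.

Lemma nat_ceil (R : realType) (x : R) : 0 < x ->
  exists m : nat, m%:R < x <= m.+1%:R.
Proof.
move=> x0; have ex : exists k : nat, x <= k%:R.
  by exists (Num.bound x); apply/ltW/archi_boundP/ltW.
case: (ex_minnP ex) => -[|m] xm min; first by move: x0; rewrite ltNge xm.
exists m; rewrite xm andbT ltNge; apply/negP => /min.
by rewrite ltnn.
Qed.

Lemma nat_floor (R : realType) (x : R) : 0 < x ->
  exists m : nat, m%:R <= x < m.+1%:R.
Proof.
move=> x0; have ex : exists k : nat, x < k%:R.
  by exists (Num.bound x); apply/archi_boundP/ltW.
case: (ex_minnP ex) => -[|m] xm min; first by move: x0; rewrite ltNge (ltW xm).
exists m; rewrite xm andbT leNgt; apply/negP => /min.
by rewrite ltnn.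
Qed.

Theorem theorem1p1 (R : realType) (md : model) (n : nat)
    (n_ge2 : (2 <= n)%N) (n_even : ~~ odd n)
    (p : R) (p_gt0 : 0 < p) (p_le1 : p <= 1)
    (d : measure_display) (T : measurableType d) (P : probability T R)
    (X : vertex n -> T -> mirror) (hX : random_mirrors md p P X) :
  (forall C : R, 0 < C -> p <= C / n%:R ->
     forall alpha : R, 0 < alpha ->
       (P [set w | (alpha / p ^+ 2)%:E <= V_half R (fun v => X v w)] <=
        (2 * A_const R md * expR (- (1 / (8 * expR C)) * alpha))%:E)%E)
  /\
  (p <= 1 / 2 ->
     forall alpha : R, 0 < alpha ->
       (P [set w | V_half R (fun v => X v w) <= (alpha / p ^+ 2)%:E] <=
        (2 * alpha)%:E)%E).
Proof.
have n_gt0 : (0 < n)%N by exact: ltnW.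
have p_ge0 := ltW p_gt0.
have p2_gt0 : 0 < p ^+ 2 by rewrite exprn_gt0.
pose E m := [set w | (0 < survivors (rows X m w))%N].
have mE m : measurable (E m) by have [] := prob_rows hX m (fun c => 0 < survivors c)%N.
have PE m : P (E m) = (survival md n p m)%:E.
  by have [] := prob_rows hX m (fun c => 0 < survivors c)%N.
split=> [C C_gt0 pC|p_half] alpha alpha_gt0.
  have x_gt0 : 0 < alpha / p ^+ 2 by rewrite divr_gt0.
  have [m /andP[mx xm]] := nat_ceil x_gt0.
  have -> : [set w | ((alpha / p ^+ 2)%:E <= V_half R (fun v => X v w))%E] = E m.
    apply/seteqP; split=> w; rewrite /E /= (V_half_geE n_even n_gt0 _ mx xm);
      by rewrite survivors_rows.
  rewrite PE lee_fin.
  apply: le_trans (survival_tail md p_gt0 p_le1 n_even n_gt0 m) _.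
  set th := rate n p.
  have th0 : 0 <= th by exact: rate_ge0.
  have th1 : th <= 9 / 512 by exact: rate_le.
  have thx : th * (alpha / p ^+ 2) = expR (- (p * n%:R)) / 8 * alpha.
    by rewrite /th /rate; field; rewrite gt_eqF.
  have pnC : expR (- C) <= expR (- (p * n%:R)).
    by rewrite ler_expR lerN2 -ler_pdivlMr ?ltr0n.
  (* Since [x <= m + 1], passing from [m] to [x] costs one more factor [expR th]. *)
  have E1 : expR (- (th * m%:R)) <= expR th * expR (- (1 / (8 * expR C)) * alpha).
    rewrite -expRD ler_expR.
    have -> : 1 / (8 * expR C) = expR (- C) / 8.
      by rewrite expRN; field; rewrite gt_eqF ?expR_gt0.
    have : th * (alpha / p ^+ 2) <= th * (m%:R + 1).
      by rewrite ler_wpM2l // natr1.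
    rewrite thx; have := ler_wpM2r (ltW alpha_gt0) pnC; lra.
  have e0 := expR_gt0 th.
  apply: le_trans (_ : 4 * expR th * (expR th * expR (- (1 / (8 * expR C)) * alpha)) <= _).
    by rewrite ler_wpM2l // mulr_ge0 // ltW.
  rewrite mulrA ler_wpM2r ?expR_ge0 //.
  (* The prefactor is [4 * expR th ^+ 2 <= 4 * (51/50)^2 <= 42/10]. *)
  have A := A_const_ge R md.
  have e1 : expR th <= 1 / (1 - th).
    rewrite ler_pdivlMr; last by lra.
    rewrite -[leRHS](expRxMexpNx_1 th) ler_wpM2l ?expR_ge0 //.
    by have := expR_ge1Dx (- th); lra.
  have : 1 / (1 - th) <= 51 / 50 by rewrite ler_pdivrMr; lra.
  nra.
have x_gt0 : 0 < alpha / p ^+ 2 by rewrite divr_gt0.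
have [m /andP[mx xm]] := nat_floor x_gt0.
have -> : [set w | (V_half R (fun v => X v w) <= (alpha / p ^+ 2)%:E)%E] = ~` E m.
  apply/seteqP; split=> w; rewrite /E /= (V_half_leE n_even n_gt0 _ mx xm);
    rewrite survivors_rows lt0n; first by move=> ->.
  by move=> /negP; rewrite negbK.
rewrite probability_setC // PE -EFinB lee_fin.
have := extinction_bound md p_ge0 p_le1 m n_even n_gt0.
have : m%:R * p ^+ 2 <= alpha by rewrite -ler_pdivlMr.
lra.
Qed.
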